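(* Let $\psi_m=\nu(\phi_p,\delta_q)\psi_q+\lambda(\phi_p)\psi_p$, with $\nu\in R[\xi_p,\xi_q]$ and $\lambda\in R[\xi_p]$, be a non-degenerate $\{\delta_p,\delta_q\}$-character of $\mathbb G_m$ over $R$, and let $\varphi\in q^{\pm1}R[[q^{\pm1}]]$ be a series whose support is contained in the set $\mathcal K'$ of totally non-characteristic integers of $\psi_m$. Then: 1) The equation $\psi_mu=\varphi$ has a unique solution $u\in\mathbb G_m(q^{\pm1}R[[q^{\pm1}]])=1+q^{\pm1}R[[q^{\pm1}]]$ such that the support of $\psi_qu$ is disjoint from the set $\mathcal K$ of characteristic integers. 2) If the reduction $\bar\varphi$ mod $p$ lies in $k[q^{\pm1}]$, then for this solution $u$ the series $\overline{\psi_qu}\in k[[q^{\pm1}]]$ (reduction mod $p$) is integral over $k[q^{\pm1}]$, and the field extension $k(q)\subset k(q,\overline{\psi_qu})$ is Abelian with Galois group killed by $p$. 3) If the characteristic polynomial of $\psi_m$ is unmixed and the support of $\varphi$ is short, then $u$ is transcendental over $K(q)$. (Signs are taken consistently; $k[q^{\pm1}]$ means $k[q]$, resp. $k[q^{-1}]$.)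
   Context: $p\ne 2$ is a prime, $R$ is the completion of the maximal unramified extension of $\mathbb Z_p$, $K=R[1/p]$, $k=R/pR$, $\phi:R\to R$ the unique automorphism lifting the $p$-power Frobenius on $k$. On $R[[q^{\pm1}]]$: $\phi_p(\sum a_nq^n)=\sum\phi(a_n)q^{pn}$, $\delta_pu=\frac{\phi_p(u)-u^p}{p}$, $\delta_q(\sum a_nq^n)=\sum na_nq^n$. For invertible $u$: $\psi_q(u)=\frac{\delta_qu}{u}$, $\psi_p(u)=\frac1p\log\frac{\phi_p(u)}{u^p}=\sum_{n\ge1}(-1)^{n-1}\frac{p^{n-1}}{n}\left(\frac{\delta_pu}{u^p}\right)^n$. For a polynomial $\nu=\sum\nu_{ij}\xi_p^i\xi_q^j$, $\nu(\phi_p,\delta_q)=\sum\nu_{ij}\phi_p^i\delta_q^j$. The characteristic polynomial of $\psi_m$ is $$\mu(\xi_p,\xi_q)=\nu(p\xi_p,\xi_q)\xi_q+\lambda(p\xi_p)(\xi_p-1)=\sum\mu_{ij}\xi_p^i\xi_q^j.$$ $\psi_m$ is non-degenerate if $\mu(0,0)\in R^\times$ (equivalently $\lambda(0)\in R^\times$). A characteristic integer is $\kappa\in\mathbb Z$ with $\mu(0,\kappa)=0$. A totally non-characteristic integer is $\kappa\in\mathbb Z$ with $\kappa\not\equiv0$ mod $p$ and $\mu(0,\kappa)\not\equiv0$ mod $p$. The support of $\sum c_nq^n$ is $\{n:c_n\neq0\}$. $\mu$ is unmixed if, with $\bar\mu_{ij}$ the reductions mod $p$ of its coefficients, $\bar\mu_{ij}=0$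 whenever $ij\neq0$, and $\bar\mu_{i0}\ne0$ for some $i\neq0$. A non-empty finite set $S$ of positive integers is short if $\max S/\min S<p/2$; a set $S$ of negative integers is short if $-S$ is short. *)

(* Defs.v *)
From HB Require Import structures.
From mathcomp Require Import all_boot all_order all_fingroup all_algebra.
From mathcomp Require Import all_solvable all_field.
From mathcomp Require Import boolp classical_sets cardinality.

Set Implicit Arguments.
Unset Strict Implicit.
Unset Printing Implicit Defensive.

Import Order.TTheory GRing.Theory Num.Theory.
Local Open Scope ring_scope.

(******************************************************************************)
(*  Formal power series A[[t]]; f m is the coefficient of t^m                 *)
(******************************************************************************)

Record fps (A : Type) := Fps { fps_coef :> nat -> A }.

HB.instance Definition _ (A : Type) := gen_eqMixin (fps A).
HB.instance Definition _ (A : Type) := gen_choiceMixin (fps A).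

Lemma fpsP (A : Type) (f g : fps A) : (forall m, f m = g m) -> f = g.
Proof. by case: f g => [f] [g] /= /funext ->. Qed.

Section FpsRing.
Variable A : comNzRingType.
Implicit Types f g h : fps A.

Definition fps_zero : fps A := Fps (fun _ => 0).
Definition fps_opp f : fps A := Fps (fun m => - f m).
Definition fps_add f g : fps A := Fps (fun m => f m + g m).
Definition fps_one : fps A := Fps (fun m => (m == 0%N)%:R).
Definition fps_mul f g : fps A :=
  Fps (fun m => \sum_(i < m.+1) f i * g (m - i)%N).
Definition fps_scale (a : A) f : fps A := Fps (fun m => a * f m).

Fact fps_addA : associative fps_add.
Proof. by move=> f g h; apply: fpsP => m /=; rewrite addrA. Qed.
Fact fps_addC : commutative fps_add.
Proof. by move=> f g; apply: fpsP => m /=; rewrite addrC. Qed.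
Fact fps_add0 : left_id fps_zero fps_add.
Proof. by move=> f; apply: fpsP => m /=; rewrite add0r. Qed.
Fact fps_addN : left_inverse fps_zero fps_opp fps_add.
Proof. by move=> f; apply: fpsP => m /=; rewrite addNr. Qed.

HB.instance Definition _ :=
  GRing.isZmodule.Build (fps A) fps_addA fps_addC fps_add0 fps_addN.

Let trunc n f : {poly A} := \poly_(i < n) f i.

Let coef_trunc n f i : (i < n)%N -> (trunc n f)`_i = f i.
Proof. by move=> lt_in; rewrite coef_poly lt_in. Qed.

Let fps_mul_trunc n f g m : (m < n)%N ->
  fps_mul f g m = (trunc n f * trunc n g)`_m.
Proof.
move=> lt_mn; rewrite coefM; apply: eq_bigr => i _.
rewrite !coef_trunc //; first exact: leq_ltn_trans (leq_subr _ _) lt_mn.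
by apply: leq_trans lt_mn; rewrite ltnS -ltnS.
Qed.

Fact fps_mulA : associative fps_mul.
Proof.
move=> f g h; apply: fpsP => m.
have lem1 u v w : fps_mul u (fps_mul v w) m
    = (trunc m.+1 u * (trunc m.+1 v * trunc m.+1 w))`_m.
  rewrite coefM; apply: eq_bigr => i _; rewrite coef_trunc //.
  by rewrite -(fps_mul_trunc (n := m.+1)) // ltnS leq_subr.
have lem2 u v w : fps_mul (fps_mul u v) w m
    = (trunc m.+1 u * trunc m.+1 v * trunc m.+1 w)`_m.
  rewrite coefM; apply: eq_bigr => i _; rewrite coef_trunc ?ltnS ?leq_subr //.
  by rewrite -(fps_mul_trunc (n := m.+1)).
by rewrite lem1 lem2 mulrA.
Qed.

Fact fps_mulC : commutative fps_mul.
Proof.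
by move=> f g; apply: fpsP => m; rewrite !(@fps_mul_trunc m.+1) // mulrC.
Qed.

Fact fps_mul1 : left_id fps_one fps_mul.
Proof.
move=> f; apply: fpsP => m /=; rewrite big_ord_recl /= mul1r subn0.
by rewrite big1 ?addr0 // => i _; rewrite mul0r.
Qed.

Fact fps_mulDl : left_distributive fps_mul fps_add.
Proof.
move=> f g h; apply: fpsP => m /=; rewrite -big_split /=.
by apply: eq_bigr => i _; rewrite mulrDl.
Qed.

Fact fps_one_neq0 : fps_one != 0.
Proof.
apply/eqP => /(congr1 (fun f : fps A => f 0%N)) /= /eqP.
by rewrite (negPf (oner_neq0 A)).
Qed.

HB.instance Definition _ := GRing.Zmodule_isComNzRing.Build (fps A)
  fps_mulA fps_mulC fps_mul1 fps_mulDl fps_one_neq0.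

Fact fps_scaleA a b f : fps_scale a (fps_scale b f) = fps_scale (a * b) f.
Proof. by apply: fpsP => m /=; rewrite mulrA. Qed.
Fact fps_scale1 : left_id 1 fps_scale.
Proof. by move=> f; apply: fpsP => m /=; rewrite mul1r. Qed.
Fact fps_scaleDr : right_distributive fps_scale +%R.
Proof. by move=> a f g; apply: fpsP => m /=; rewrite mulrDr. Qed.
Fact fps_scaleDl f : {morph fps_scale^~ f : a b / a + b}.
Proof. by move=> a b; apply: fpsP => m /=; rewrite mulrDl. Qed.

HB.instance Definition _ := GRing.Zmodule_isLmodule.Build A (fps A)
  fps_scaleA fps_scale1 fps_scaleDr fps_scaleDl.

Fact fps_scaleAl (a : A) f g : a *: (f * g) = (a *: f) * g.
Proof.
apply: fpsP => m /=; rewrite mulr_sumr.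
by apply: eq_bigr => i _; rewrite mulrA.
Qed.

HB.instance Definition _ :=
  GRing.Lmodule_isLalgebra.Build A (fps A) fps_scaleAl.

Definition fps_unit : pred (fps A) := fun f => `[< exists g, g * f = 1 >].
Definition fps_inv f : fps A :=
  if pselect (exists g, g * f = 1) is left e then projT1 (cid e) else f.

Fact fps_mulVf : {in fps_unit, left_inverse 1 fps_inv *%R}.
Proof.
move=> f /asboolP uf; rewrite /fps_inv; case: pselect => // e.
exact: projT2 (cid e).
Qed.
Fact fps_unitP f g : g * f = 1 -> fps_unit f.
Proof. by move=> gf1; apply/asboolP; exists g. Qed.
Fact fps_inv_out : {in [predC fps_unit], fps_inv =1 id}.
Proof.
move=> f /asboolP nuf; rewrite /fps_inv; case: pselect => // e.
Qed.

HB.instance Definition _ := GRing.ComNzRing_hasMulInverse.Build (fps A)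
  fps_mulVf fps_unitP fps_inv_out.

End FpsRing.

Section FpsDomain.
Variable A : idomainType.

Fact fps_mulf_eq0 : GRing.integral_domain_axiom (fps A).
Proof.
move=> f g fg0; apply/orP.
have nz (h : fps A) : h != 0 -> exists n, h n != 0.
  move=> h0; apply/not_existsP => hn; case/negP: h0; apply/eqP.
  by apply: fpsP => n; apply/eqP; apply/negPn/negP/hn.
case: (eqVneq f 0) => [|f0]; [by left | right].
apply/negPn/negP => g0.
case: (ex_minnP (nz f f0)) => i fi imin.
case: (ex_minnP (nz g g0)) => j gj jmin.
have low (h : fps A) l : (forall n, h n != 0 -> (l <= n)%N) ->
    forall n, (n < l)%N -> h n = 0.
  by move=> hl n ltn; apply/eqP; apply: contraTT ltn => /hl; rewrite -leqNgt.
have := congr1 (fun h : fps A => h (i + j)%N) fg0; rewrite /=.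
have lti : (i < (i + j).+1)%N by rewrite ltnS leq_addr.
rewrite (bigD1 (Ordinal lti)) //= big1 => [|l /eqP nl].
  rewrite addr0 addKn => /eqP; rewrite mulf_eq0.
  by rewrite (negPf fi) (negPf gj).
case: (ltngtP l i) => [ltl|ltl|el].
- by rewrite (low _ _ imin l ltl) mul0r.
- rewrite (low _ _ jmin) ?mulr0 // ltn_subLR ?ltn_add2r //.
  by rewrite -ltnS.
- by case: nl; apply: val_inj.
Qed.

HB.instance Definition _ :=
  GRing.ComUnitRing_isIntegral.Build (fps A) fps_mulf_eq0.

End FpsDomain.

Definition map_fps (A B : Type) (h : A -> B) (f : fps A) : fps B :=
  Fps (fun m => h (f m)).

Definition fps_of_poly (A : nzRingType) (P : {poly A}) : fps A :=
  Fps (fun m => P`_m).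

(* The embedding F(t) -> F((t)) = Frac F[[t]], on the representative fraction *)
(* of x.                                                                      *)
Definition ratl (F : fieldType) (x : {fraction {poly F}}) : {fraction fps F} :=
  let r := generic_quotient.repr x in
  FracField.tofrac (fps_of_poly \n_r) / FracField.tofrac (fps_of_poly \d_r).

(******************************************************************************)
(*  Exact quotients and p-adic sums                                           *)
(******************************************************************************)

(* The c with b * c = a; unique when b != 0 in a domain, junk if there is     *)
(* none.                                                                      *)
Definition quo (A : comNzRingType) (a b : A) : A := xget 0 [set c | b * c = a].

Definition congr_mod (A : comNzRingType) (b x y : A) : Prop :=
  exists z, x - y = b * z.

Definition padic_lim (A : comNzRingType) (p : nat) (a : nat -> A) (l : A) :=
  forall N, exists M, forall n, (M <= n)%N -> congr_mod (p ^ N)%:R (a n) l.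

Definition padic_sum (A : comNzRingType) (p : nat) (a : nat -> A) : A :=
  xget 0 [set l | padic_lim p (fun n => \sum_(i < n) a i) l].

(******************************************************************************)
(*  The ground ring                                                           *)
(******************************************************************************)

(* The completion of the maximal unramified extension of Z_p is, up to        *)
(* isomorphism, the only complete discrete valuation ring with uniformizer p  *)
(* whose residue field is an algebraic closure of F_p. The residue field      *)
(* R / pR is given by a surjective morphism red : R -> k with kernel pR.      *)
Record unramified_completion (p : nat) (R : idomainType) (k : fieldType)
    (red : {rmorphism R -> k}) : Prop := UnramifiedCompletion {
  uc_prime : prime p;
  uc_surj : forall y : k, exists x : R, red x = y;
  uc_ker : forall x : R, red x = 0 <-> exists y, x = p%:R * y;
  uc_p_neq0 : p%:R != 0 :> R;
  uc_separated : forall x : R,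
    (forall N, congr_mod (p ^ N)%:R x 0) -> x = 0;
  uc_complete : forall a : nat -> R,
    (forall N, congr_mod (p ^ N)%:R (a N.+1) (a N)) -> exists l, padic_lim p a l;
  uc_closed : GRing.closed_field_axiom k;
  uc_algebraic : forall y : k, algebraicOver (fun a : 'F_p => (a : nat)%:R) y
}.

Record frobenius_lift (p : nat) (R : idomainType) (k : fieldType)
    (red : {rmorphism R -> k}) (phi : {rmorphism R -> R}) : Prop :=
  FrobeniusLift {
  fl_bij : bijective phi;
  fl_red : forall x, red (phi x) = red x ^+ p
}.

(******************************************************************************)
(*  Operators on R[[q^{+-1}]] and {delta_p, delta_q}-characters of G_m        *)
(*                                                                            *)
(*  Both signs are handled by s : bool: an f : fps R stands for a series in   *)
(*  t = q^((-1)^s), so that f m is the coefficient of q^(qexp s m). As        *)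
(*  F(q) = F(t), the field F(q) is {fraction {poly F}} for either sign.       *)
(******************************************************************************)

Definition qexp (s : bool) (m : nat) : int := (-1) ^+ s * m%:Z.

Definition supp (A : nmodType) (s : bool) (f : fps A) : set int :=
  [set n | exists2 m, n = qexp s m & f m != 0].

Section Characters.
Variables (p : nat) (R : idomainType) (phi : {rmorphism R -> R}) (s : bool).
Implicit Types (u f : fps R) (nu : {poly {poly R}}) (lambda : {poly R}).

Definition delta_q f : fps R := Fps (fun m => (qexp s m)%:~R * f m).

Definition phi_p f : fps R :=
  Fps (fun m => if (p %| m)%N then phi (f (m %/ p)%N) else 0).

Definition delta_p u : fps R := quo (phi_p u - u ^+ p) p%:R.

Definition psi_q u : fps R := delta_q u / u.

(* The n-th term of the sum is the (n+1)-st term of the logarithmic series.   *)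
Definition psi_p u : fps R :=
  padic_sum p (fun n => ((-1) ^+ n * quo (p ^ n)%:R n.+1%:R : R)
                          *: (delta_p u / u ^+ p) ^+ n.+1).

(* A polynomial in xi_p, xi_q is a polynomial in xi_p with coefficients in    *)
(* R[xi_q]: nu_ij = nu`_i`_j, xi_p = 'X and xi_q = 'X%:P.                     *)
Definition nu_op nu f : fps R :=
  \sum_(i < size nu) \sum_(j < size nu`_i)
    nu`_i`_j *: iter i phi_p (iter j delta_q f).

Definition lambda_op lambda f : fps R :=
  \sum_(i < size lambda) lambda`_i *: iter i phi_p f.

Definition psi_m nu lambda u : fps R :=
  nu_op nu (psi_q u) + lambda_op lambda (psi_p u).

Definition char_poly2 nu lambda : {poly {poly R}} :=
  (nu \Po (p%:R *: 'X)) * 'X%:P + (lambda \Po (p%:R *: 'X))^:P * ('X - 1).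

Definition mu0 (mu : {poly {poly R}}) (x : R) : R := mu.[0].[x].

Definition nondeg_char (mu : {poly {poly R}}) : Prop :=
  mu0 mu 0 \is a GRing.unit.

Definition char_ints (mu : {poly {poly R}}) : set int :=
  [set n | mu0 mu n%:~R = 0].

Section Residue.
Variables (k : fieldType) (red : {rmorphism R -> k}).

Definition totally_nonchar_ints (mu : {poly {poly R}}) : set int :=
  [set n | ~~ (p %| n)%Z /\ red (mu0 mu n%:~R) != 0].

Definition unmixed (mu : {poly {poly R}}) : Prop :=
  (forall i j, (i * j != 0)%N -> red mu`_i`_j = 0)
  /\ (exists2 i, i != 0%N & red mu`_i`_0%N != 0).

End Residue.

Definition is_solution nu lambda f u : Prop :=
  [/\ u 0%N = 1, psi_m nu lambda u = f
    & (supp s (psi_q u) `&` char_ints (char_poly2 nu lambda) = set0)%classic].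

End Characters.

(******************************************************************************)
(*  Short sets, abelian extensions, transcendence                             *)
(******************************************************************************)

Definition short_pos (p : nat) (S : set int) : Prop :=
  [/\ finite_set S, (forall n, S n -> 0 < n) &
    exists a b, [/\ S a, S b, (forall n, S n -> a <= n <= b)
                  & b%:Q / a%:Q < p%:Q / 2]].

Definition short (p : nat) (S : set int) : Prop :=
  short_pos p S \/ short_pos p [set n | S (- n)].

(* With F embedded in E by f, the subextension F(x) of E is an abelian Galois *)
(* extension of F whose group is killed by n. The extension F(x) is given by  *)
(* L, g and y: the F-embedding g : L -> E has image F(x), since L = F(y) and  *)
(* g y = x.                                                                   *)
Definition abelian_killed_by (n : nat) (F E : fieldType) (f : F -> E) (x : E)
    : Prop :=
  exists (L : splittingFieldType F) (g : {rmorphism L -> E}) (y : L),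
    [/\ (forall a : F, g a%:A = f a), g y = x & <<1; y>>%VS = {:L}%VS]
    /\ [/\ galois 1 {:L}, abelian 'Gal({:L} / 1)
          & (exponent 'Gal({:L} / 1) %| n)%N].

Definition transcendental_over_ratl (F : fieldType) (x : fps F) : Prop :=
  ~ algebraicOver (@ratl F) (FracField.tofrac x).

(* Main.v *)
Require Import Defs.
From HB Require Import structures.
From mathcomp Require Import all_boot all_order all_fingroup all_algebra.
From mathcomp Require Import all_solvable all_field.
From mathcomp Require Import ring zify.
From mathcomp Require Import boolp classical_sets cardinality.

Set Implicit Arguments.
Unset Strict Implicit.
Unset Printing Implicit Defensive.

Import Order.TTheory GRing.Theory Num.Theory.
Local Open Scope ring_scope.

(* The equation psi_m u = f is solved for the logarithmic derivative
   v = psi_q u. Since delta_q psi_p u = (phi_p - 1) v, applying delta_q turns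
   it into the linear equation mu(phi_p, delta_q) v = delta_q f, which is
   triangular: the coefficient v_n is multiplied by mu(0, n), and the other
   terms involve v_(n/p^i) with i >= 1. Its solution satisfies
   v_n = phi(v_(n/p)) mod n, because
   mu = lambda(p xi_p) (xi_p - 1) + nu(p xi_p, xi_q) xi_q
   with lambda(0) invertible, and by Dwork's lemma these congruences make the
   formal solution u of delta_q u = v u integral.
   Modulo p they say that v - v^p is a polynomial: an Artin-Schreier equation.
   If u were algebraic over K(q), then v and all delta_q^i v would lie in a
   finite-dimensional K(q)-space, so the coefficients of v would satisfy a
   linear recurrence with polynomial coefficients. But the support of v is
   infinite and contained in the union of the intervals p^e [a, b], where
   [a, b] contains the support of f and b < p a: v has arbitrarily long gaps. *)

(** * Formal power series *)

Section FpsTheory.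
Variable A : comNzRingType.
Implicit Types (f g h : fps A) (P Q : {poly A}).

Lemma fpsM f g m : (f * g) m = \sum_(i < m.+1) f i * g (m - i)%N.
Proof. by []. Qed.

Lemma fps_of_polyE P m : fps_of_poly P m = P`_m.
Proof. by []. Qed.

Lemma fpsB f g m : (f - g) m = f m - g m.
Proof. by []. Qed.

Lemma fps_sum I (r : seq I) (P : pred I) (F : I -> fps A) m :
  (\sum_(i <- r | P i) F i) m = \sum_(i <- r | P i) F i m.
Proof. by elim/big_rec2: _ => // i x y _ <-. Qed.

Lemma fps_natM n f m : (n%:R * f) m = n%:R * f m.
Proof.
by rewrite !mulr_natl; elim: n => [|n IHn]; rewrite ?mulr0n // !mulrS -IHn.
Qed.

Lemma fpsM0 f g : (f * g) 0%N = f 0%N * g 0%N.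
Proof. by rewrite fpsM big_ord1. Qed.

Lemma fpsX0 f n : (f ^+ n) 0%N = f 0%N ^+ n.
Proof. by elim: n => // n IHn; rewrite !exprS fpsM0 IHn. Qed.

Lemma fpsM_local f f' g g' m :
    (forall i, (i <= m)%N -> f i = f' i) ->
    (forall i, (i <= m)%N -> g i = g' i) ->
  (f * g) m = (f' * g') m.
Proof.
move=> ef eg; rewrite !fpsM; apply: eq_bigr => i _.
by rewrite ef ?eg ?leq_subr // -ltnS.
Qed.

Lemma fps_of_poly_is_zmod_morphism : zmod_morphism (@fps_of_poly A).
Proof. by move=> P Q; apply: fpsP => m; rewrite fpsB !fps_of_polyE coefB. Qed.

Lemma fps_of_poly_is_monoid_morphism : monoid_morphism (@fps_of_poly A).
Proof.
by split=> [|P Q]; apply: fpsP => m; rewrite fps_of_polyE ?coef1 ?coefM.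
Qed.

HB.instance Definition _ := GRing.isZmodMorphism.Build {poly A} (fps A)
  (@fps_of_poly A) fps_of_poly_is_zmod_morphism.
HB.instance Definition _ := GRing.isMonoidMorphism.Build {poly A} (fps A)
  (@fps_of_poly A) fps_of_poly_is_monoid_morphism.

Lemma fps_of_polyM : {morph @fps_of_poly A : P Q / P * Q}.
Proof. exact: rmorphM. Qed.

Lemma fps_of_poly_inj : injective (@fps_of_poly A).
Proof.
move=> P Q eqPQ; apply/polyP => m.
exact: (congr1 (fun f : fps A => f m) eqPQ).
Qed.

Definition fps_trunc n f : {poly A} := \poly_(i < n) f i.

Lemma fps_truncE n f i : (i < n)%N -> fps_of_poly (fps_trunc n f) i = f i.
Proof. by move=> lt_in; rewrite fps_of_polyE coef_poly lt_in. Qed.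

(** Course-of-values recursion. Iterating the functional from the zero sequence fixes the value at
    [m] after more than [m] rounds, so the diagonal of the iterates is a solution. *)
Lemma fps_rec (F : nat -> (nat -> A) -> A) :
    (forall m a b, (forall i, (i < m)%N -> a i = b i) -> F m a = F m b) ->
  exists f, forall m, f m = F m f.
Proof.
move=> extF; pose a n := iter n (fun a m => F m a) (fun _ => 0).
have stab m : forall i j, (m < i)%N -> (m < j)%N -> a i m = a j m.
  elim/ltn_ind: m => m IHm [|i] [|j] // lti ltj.
  by apply: extF => l ltl; apply: IHm => //; apply: leq_trans ltl _.
exists (Fps (fun m => a m.+1 m)) => m; rewrite -[LHS]/(F m (a m)).
by apply: extF => i lti; apply: (stab i m i.+1).
Qed.

Lemma fps_unit1 f : f 0%N = 1 -> f \is a GRing.unit.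
Proof.
move=> f0; pose F m (a : nat -> A) :=
  (m == 0%N)%:R - \sum_(i < m) a i * f (m - i)%N.
have [|g gE] := fps_rec (F := F).
  by move=> m a b eqab; congr (_ - _); apply: eq_bigr => i _; rewrite eqab.
apply/unitrPr; exists g; rewrite mulrC; apply: fpsP => m.
by rewrite fpsM big_ord_recr /= subnn f0 mulr1 gE /F addrC subrK.
Qed.

End FpsTheory.

Section FpsIntegral.
Variables (A : idomainType) (s : bool).
Implicit Types (f g h : fps A).

Definition qn m : A := (qexp s m)%:~R.

Lemma qnE m : qn m = (-1) ^+ s * m%:R.
Proof. by rewrite /qn /qexp intrM rmorphXn /= rmorphN1. Qed.

Lemma qnD m n : qn (m + n) = qn m + qn n.
Proof. by rewrite !qnE natrD mulrDr. Qed.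

Lemma qnM m n : qn (m * n) = m%:R * qn n.
Proof. by rewrite !qnE natrM mulrCA. Qed.

Lemma qn0 : qn 0 = 0.
Proof. by rewrite qnE mulr0. Qed.

Lemma delta_qE f m : delta_q s f m = qn m * f m.
Proof. by []. Qed.

Lemma delta_q0 f : delta_q s f 0%N = 0.
Proof. by rewrite delta_qE qn0 mul0r. Qed.

Lemma delta_q_is_zmod_morphism : zmod_morphism (@delta_q A s).
Proof. by move=> f g; apply: fpsP => m; rewrite fpsB !delta_qE fpsB mulrBr. Qed.

HB.instance Definition _ := GRing.isZmodMorphism.Build (fps A) (fps A)
  (@delta_q A s) delta_q_is_zmod_morphism.

Lemma delta_qD f g : delta_q s (f + g) = delta_q s f + delta_q s g.
Proof. exact: raddfD. Qed.

Lemma delta_qM f g : delta_q s (f * g) = delta_q s f * g + f * delta_q s g.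
Proof.
apply: fpsP => m; rewrite delta_qE fpsM mulr_sumr -[RHS]/(_ + _) !fpsM.
rewrite -big_split; apply: eq_bigr => -[i /= lti] _.
rewrite -/(qn i) -/(qn (m - i)) -{1}(subnKC (n := m) (m := i)) //.
by rewrite qnD mulrDl !mulrA [f i * qn _]mulrC.
Qed.

Lemma delta_qZ a f : delta_q s (a *: f) = a *: delta_q s f.
Proof. by apply: fpsP => m; rewrite /= mulrCA. Qed.

Lemma delta_q_nat n f : delta_q s (n%:R * f) = n%:R * delta_q s f.
Proof. by rewrite !mulr_natl raddfMn. Qed.

Lemma delta_q1 : delta_q s (1 : fps A) = 0.
Proof.
by apply: fpsP => -[|m]; rewrite ?delta_q0 // delta_qE mulr0.
Qed.

Lemma delta_qX f n : delta_q s (f ^+ n.+1) = n.+1%:R * (f ^+ n * delta_q s f).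
Proof.
elim: n => [|n IHn]; first by rewrite expr1 expr0 !mul1r.
rewrite exprS delta_qM IHn -[n.+2%:R]natr1 exprS.
by set x := delta_q s f; set y := f ^+ n; set z := n.+1%:R; ring.
Qed.

End FpsIntegral.

(** * The operator [phi_p] and its multiplicativity *)

Section PhiP.
Variables (p : nat) (R : idomainType) (phi : {rmorphism R -> R}).
Hypothesis p_gt0 : (0 < p)%N.
Implicit Types (f g h : fps R).
Local Notation phip := (phi_p p phi).

Lemma phi_pE f m :
  phip f m = if (p %| m)%N then phi (f (m %/ p)%N) else 0.
Proof. by []. Qed.

Lemma phi_p0 f : phip f 0%N = phi (f 0%N).
Proof. by rewrite phi_pE dvdn0 div0n. Qed.

Lemma iter_phi_pE i f m : iter i phip f m =
  if (p ^ i %| m)%N then iter i phi (f (m %/ p ^ i)%N) else 0.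
Proof.
elim: i m => [|i IHi] m; first by rewrite expn0 dvd1n divn1.
rewrite iterS phi_pE IHi expnS; case: ifP => pm; last first.
  by case: ifP => // /(dvdn_trans (dvdn_mulr _ (dvdnn p))); rewrite pm.
rewrite divnMA -(dvdn_pmul2l p_gt0) [(p * (m %/ p))%N]mulnC divnK //.
by case: ifP => // _; rewrite rmorph0.
Qed.

Lemma phi_p_is_zmod_morphism : zmod_morphism phip.
Proof.
move=> f g; apply: fpsP => m; rewrite fpsB !phi_pE.
by case: ifP => _; rewrite ?subr0 // rmorphB.
Qed.

Lemma phi_p_poly (P : {poly R}) :
  phip (fps_of_poly P) = fps_of_poly (map_poly phi P \Po 'X^p).
Proof.
apply: fpsP => m; rewrite phi_pE !fps_of_polyE coef_comp_poly_Xn //.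
by case: ifP => _ //; rewrite coef_map.
Qed.

Lemma phi_p_local f g m : (forall i, (i <= m)%N -> f i = g i) ->
  forall i, (i <= m)%N -> phip f i = phip g i.
Proof.
move=> eqfg i le_im; rewrite !phi_pE; case: ifP => // _; congr (phi _).
by apply/eqfg/(leq_trans (leq_div _ _)).
Qed.

(** The coefficient at [m] depends only on truncations beyond degree [m]. On polynomials the
    operator is [phi] on coefficients followed by the substitution of ['X^p], which is
    multiplicative. *)
Lemma phi_p_is_monoid_morphism : monoid_morphism phip.
Proof.
split=> [|f g]; apply: fpsP => m.
  rewrite phi_pE /=; case: ifP => [|/negbT pm].
    move=> /dvdnP[q ->]; rewrite mulnK // muln_eq0 (gtn_eqF p_gt0) orbF.
    by rewrite rmorph_nat.
  by case: eqP pm => // ->; rewrite dvdn0.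
have tr (h : fps R) i : (i <= m)%N -> h i = fps_of_poly (fps_trunc m.+1 h) i.
  by move=> le_im; rewrite fps_truncE.
transitivity (phip (fps_of_poly (fps_trunc m.+1 f * fps_trunc m.+1 g)) m).
  apply: (@phi_p_local _ _ m) => // i le_im; rewrite fps_of_polyM.
  by apply: fpsM_local => j le_ji; apply/tr/(leq_trans le_ji).
set F := fps_trunc _ f; set G := fps_trunc _ g; rewrite phi_p_poly.
have -> : map_poly phi (F * G) = map_poly phi F * map_poly phi G.
  exact: rmorphM.
rewrite comp_polyM fps_of_polyM -!phi_p_poly.
by apply: fpsM_local; apply: phi_p_local => i le_im; rewrite [RHS]tr.
Qed.

HB.instance Definition _ := GRing.isZmodMorphism.Build (fps R) (fps R)
  phip phi_p_is_zmod_morphism.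

End PhiP.

(** * The p-th power map on series in characteristic p *)

Section FrobeniusFps.
Variables (p : nat) (k : fieldType).
Hypothesis pchark : p \in [pchar k].

Let p_gt0 : (0 < p)%N := prime_gt0 (pcharf_prime pchark).

Lemma fps_pchar : p \in [pchar (fps k)].
Proof. exact: (rmorph_pchar (@fps_of_poly k \o polyC) pchark). Qed.

Lemma poly_Frobenius (P : {poly k}) :
  P ^+ p = map_poly (pFrobenius_aut pchark) P \Po 'X^p.
Proof.
have pcharP : p \in [pchar {poly k}] := rmorph_pchar polyC pchark.
elim/poly_ind: P => [|P c IHP].
  by rewrite expr0n gtn_eqF // !rmorph0.
have -> : (P * 'X + c%:P) ^+ p = (P * 'X) ^+ p + c%:P ^+ p.
  exact: (rmorphD (pFrobenius_aut pcharP)).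
rewrite exprMn IHP.
rewrite rmorphD rmorphM /= map_polyX map_polyC /= pFrobenius_autE.
by rewrite comp_polyD comp_polyM comp_polyX comp_polyC polyC_exp.
Qed.

(** Write f = P + h with P a polynomial and h zero up to degree [m]. Then f^p = P^p + h^p, and h^p
    does not reach degree [m]. *)
Lemma fps_Frobenius (f : fps k) : phi_p p (pFrobenius_aut pchark) f = f ^+ p.
Proof.
apply: fpsP => m; pose P := fps_trunc m.+1 f; pose h := f - fps_of_poly P.
have h0 i : (i <= m)%N -> h i = 0.
  move=> le_im; rewrite -[LHS]/(f i - fps_of_poly P i) fps_truncE //.
  by rewrite subrr.
have fE : f = fps_of_poly P + h by rewrite /h addrC subrK.
have -> : f ^+ p = fps_of_poly P ^+ p + h ^+ p.
  by rewrite {1}fE; apply: (rmorphD (pFrobenius_aut fps_pchar)).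
have -> : fps_of_poly P ^+ p = fps_of_poly (P ^+ p) by rewrite rmorphXn.
rewrite poly_Frobenius.
rewrite -phi_p_poly // -[RHS]/(_ m + (h ^+ p) m).
have -> : (h ^+ p) m = 0.
  rewrite -(prednK p_gt0) exprS.
  rewrite (@fpsM_local _ _ 0 _ (h ^+ p.-1) m) ?mul0r //.
rewrite addr0; apply: (@phi_p_local _ _ _ _ _ m) => // i le_im.
by rewrite fps_truncE.
Qed.

End FrobeniusFps.

Section MapFps.
Variables (A B : comNzRingType) (h : {rmorphism A -> B}).

Lemma map_fpsE f m : map_fps h f m = h (f m).
Proof. by []. Qed.

Lemma map_fps_is_zmod_morphism : zmod_morphism (map_fps h).
Proof. by move=> f g; apply: fpsP => m; rewrite fpsB !map_fpsE rmorphB. Qed.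

Lemma map_fps_is_monoid_morphism : monoid_morphism (map_fps h).
Proof.
split=> [|f g]; apply: fpsP => m; first by rewrite map_fpsE rmorph_nat.
by rewrite map_fpsE rmorph_sum; apply: eq_bigr => i _; rewrite rmorphM.
Qed.

HB.instance Definition _ := GRing.isZmodMorphism.Build (fps A) (fps B)
  (map_fps h) map_fps_is_zmod_morphism.
HB.instance Definition _ := GRing.isMonoidMorphism.Build (fps A) (fps B)
  (map_fps h) map_fps_is_monoid_morphism.

End MapFps.

(** This congruence makes [delta_p] an exact quotient, and it later turns phi_p v - v mod p into the
    Artin-Schreier expression v^p - v. *)
Lemma map_fps_phi_p (p : nat) (R : idomainType) (k : fieldType)
    (red : {rmorphism R -> k}) (phi : {rmorphism R -> R}) (f : fps R) :
    p \in [pchar k] -> (forall x, red (phi x) = red x ^+ p) ->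
  map_fps red (phi_p p phi f) = map_fps red f ^+ p.
Proof.
move=> pchark redphi; rewrite -(fps_Frobenius pchark); apply: fpsP => m.
rewrite map_fpsE !phi_pE.
by case: ifP => _; rewrite ?rmorph0 // redphi pFrobenius_autE.
Qed.


(** * The ground ring *)

Section Divides.
Variable A : comNzRingType.
Implicit Types (b x y : A).

Definition divides b x := exists z, x = b * z.

Lemma divides0 b : divides b 0.
Proof. by exists 0; rewrite mulr0. Qed.

Lemma dividesD b x y : divides b x -> divides b y -> divides b (x + y).
Proof. by move=> [z ->] [t ->]; exists (z + t); rewrite mulrDr. Qed.

Lemma dividesN b x : divides b x -> divides b (- x).
Proof. by move=> [z ->]; exists (- z); rewrite mulrN. Qed.

Lemma dividesB b x y : divides b x -> divides b y -> divides b (x - y).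
Proof. by move=> bx /dividesN; apply: dividesD. Qed.

Lemma dividesMr b x y : divides b x -> divides b (x * y).
Proof. by move=> [z ->]; exists (z * y); rewrite mulrA. Qed.

Lemma dividesMl b x y : divides b x -> divides b (y * x).
Proof. by rewrite mulrC; apply: dividesMr. Qed.

Lemma divides_refl b : divides b b.
Proof. by exists 1; rewrite mulr1. Qed.

Lemma divides_sum b I (r : seq I) (P : pred I) (F : I -> A) :
  (forall i, P i -> divides b (F i)) -> divides b (\sum_(i <- r | P i) F i).
Proof.
by move=> bF; elim/big_ind: _ => //; [apply: divides0 | apply: dividesD].
Qed.

Lemma divides_exp p m n : (m <= n)%N -> divides (p ^ m)%:R ((p ^ n)%:R : A).
Proof.
by move=> le_mn; exists (p ^ (n - m))%:R; rewrite -natrM -expnD subnKC.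
Qed.

Lemma divides_congr b x : divides b x -> congr_mod b x 0.
Proof. by move=> [z ->]; exists z; rewrite subr0. Qed.

Lemma quoP x b : divides b x -> b * quo x b = x.
Proof.
move=> [z xE]; have := @xgetPex A 0 [set c | b * c = x]%classic.
by apply; exists z.
Qed.

End Divides.

Lemma fps_divides (A : comNzRingType) n (f : fps A) :
  (forall m, divides n%:R (f m)) -> divides n%:R f.
Proof.
move=> /choice[g gE]; exists (Fps g); apply: fpsP => m.
by rewrite fps_natM gE.
Qed.

Lemma coef_divides (A : comNzRingType) n (f : fps A) m :
  divides n%:R f -> divides n%:R (f m).
Proof. by move=> [g ->]; exists (g m); rewrite fps_natM. Qed.

Section GroundRing.
Variables (p : nat) (R : idomainType) (k : fieldType).
Variable red : {rmorphism R -> k}.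
Hypothesis hR : unramified_completion p red.

Let p_prime := uc_prime hR.

Lemma residue_pchar : p \in [pchar k].
Proof.
rewrite inE p_prime -(rmorph_nat red); apply/eqP/(uc_ker hR).
by exists 1; rewrite mulr1.
Qed.

Lemma red_eq0P (x : R) : red x = 0 <-> divides p%:R x.
Proof. exact: uc_ker hR x. Qed.

Lemma divides_pexp_eq0 (x : R) : (forall N, divides (p ^ N)%:R x) -> x = 0.
Proof. by move=> px; apply: (uc_separated hR) => N; apply/divides_congr. Qed.

(** If y lifts the inverse residue, then x y = 1 - p z, and the geometric sums of p z converge to an
    inverse of 1 - p z. *)
Lemma unit_of_red (x : R) : red x != 0 -> x \is a GRing.unit.
Proof.
move=> rx0; have [y ry] := uc_surj hR (red x)^-1.
have /red_eq0P[z zE] : red (1 - x * y) = 0.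
  by rewrite rmorphB rmorph1 rmorphM ry mulfV ?subrr.
pose a n := \sum_(i < n) (p%:R * z) ^+ i.
have pX N : divides (p ^ N)%:R ((p%:R * z) ^+ N).
  by exists (z ^+ N); rewrite exprMn natrX.
have [N|l al] := uc_complete hR (a := a).
  by rewrite /congr_mod /a big_ord_recr /= addrAC subrr add0r; apply: pX.
apply/unitrPr; exists (y * l); apply/eqP; rewrite -subr_eq0; apply/eqP.
apply: divides_pexp_eq0 => N; have [M aM] := al N.
have [w wE] := aM (maxn M N) (leq_maxl M N).
have -> : x * (y * l) - 1 = (1 - p%:R * z) * (l - a (maxn M N))
    + ((1 - p%:R * z) * a (maxn M N) - 1).
  by rewrite -zE; ring.
apply: dividesD.
  by apply: dividesMl; exists (- w); rewrite mulrN -wE opprB.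
have := subrX1 (p%:R * z) (maxn M N); rewrite -/(a _) => E.
set b := a _ in E *; set t := _ ^+ _ in E.
have -> : (1 - p%:R * z) * b - 1 = - t.
  by rewrite -(subrK 1 t) E; ring.
apply: dividesN; rewrite /t.
have [w' ->] := pX (maxn M N); apply: dividesMr.
by apply: divides_exp; apply: leq_maxr.
Qed.

Lemma coprime_unit n : coprime p n -> (n%:R : R) \is a GRing.unit.
Proof.
move=> cpn; apply: unit_of_red; rewrite rmorph_nat.
by rewrite -(dvdn_pcharf residue_pchar) -prime_coprime.
Qed.

Lemma ground_natr_eq0 n : (n%:R == 0 :> R) = (n == 0%N).
Proof.
case: n => [|n]; rewrite ?eqxx //; apply/negbTE.
have [b cpb ->] := pfactor_coprime p_prime (ltn0Sn n).
rewrite natrM mulf_neq0 //.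
  by apply: contraTneq (coprime_unit cpb) => ->; rewrite unitr0.
by rewrite natrX expf_neq0 // (uc_p_neq0 hR).
Qed.

Lemma qn_eq0 s m : (qn R s m == 0) = (m == 0%N).
Proof. by rewrite qnE mulf_eq0 signr_eq0 ground_natr_eq0. Qed.

(** If p^a exactly divides n + 1, then 2^a <= n + 1, so p^n / (n + 1) has valuation n - a, which is
    at least the integer part of n / 2. Thus the coefficients of the logarithmic series are integral
    and tend to 0. *)
Lemma pexp_quo n : exists c, [/\ n.+1%:R * c = (p ^ n)%:R :> R
  & forall N, (N.*2 <= n)%N -> divides (p ^ N)%:R c].
Proof.
have [b cpb nE] := pfactor_coprime p_prime (ltn0Sn n).
set a := logn p n.+1 in nE; have ub := coprime_unit cpb.
have lt_a : (2 ^ a <= n.+1)%N.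
  rewrite nE -[(2 ^ a)%N]mul1n leq_mul //.
    by case: b cpb {ub} nE => //; rewrite mul0n.
  by case: (a) => // a'; rewrite leq_exp2r // (prime_gt1 p_prime).
have le_an : (a <= n)%N by rewrite -ltnS (leq_trans _ lt_a) // ltn_expl.
exists ((p ^ (n - a))%:R / b%:R); split=> [|N le_N].
  by rewrite nE mulrC natrM mulrA divrK // -natrM -expnD subnK.
apply/dividesMr/divides_exp.
have := ltn_expl (n - N).+1 (isT : (1 < 2)%N).
case: (leqP N (n - a)) => // ltN lt2.
(* If n - a < N, then a >= n - N + 1, so 2^(n - N + 1) <= n + 1; but 2N <= n makes this power at
   least n + 2. *)
have : (2 ^ (n - N).+1 <= n.+1)%N.
  by apply: leq_trans lt_a; rewrite leq_exp2l //; lia.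
have := ltn_expl (n - N) (isT : (1 < 2)%N).
rewrite expnS; lia.
Qed.

Lemma pexp_quoE n : n.+1%:R * quo (p ^ n)%:R n.+1%:R = (p ^ n)%:R :> R.
Proof. by have [c [cE _]] := pexp_quo n; apply: quoP; exists c. Qed.

Lemma divides_pexp_quo N n : (N.*2 <= n)%N ->
  divides (p ^ N)%:R (quo (p ^ n)%:R n.+1%:R : R).
Proof.
have [c [cE dc]] := pexp_quo n => /dc.
suff -> : quo (p ^ n)%:R n.+1%:R = c by [].
apply: (mulfI (_ : n.+1%:R != 0)); first by rewrite ground_natr_eq0.
by rewrite pexp_quoE.
Qed.

(** The tail estimate is uniform in the coefficients, so the coefficientwise limits form a limit of
    series, and [padic_sum] does not take its default value. *)
Lemma fps_padic_sum (a : nat -> fps R) :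
    (forall N n, (N.*2 <= n)%N -> divides (p ^ N)%:R (a n)) ->
  padic_lim p (fun n => \sum_(i < n) a i) (padic_sum p a).
Proof.
move=> da; pose S n := \sum_(i < n) a i.
have tail N j : divides (p ^ N)%:R (S (N.*2 + j)%N - S N.*2).
  elim: j => [|j IHj]; first by rewrite addn0 subrr; apply: divides0.
  rewrite addnS /S big_ord_recr /= addrAC; apply: dividesD => //.
  exact/da/leq_addr.
have {}tail N n n' : (N.*2 <= n)%N -> (N.*2 <= n')%N ->
    divides (p ^ N)%:R (S n - S n').
  move=> /subnKC <- /subnKC <-.
  have := dividesB (tail N (n - N.*2)%N) (tail N (n' - N.*2)%N).
  by rewrite opprB addrA subrK.
(* Partial sums are sampled at length 2N, so that consecutive samples agree mod p^N as completeness
   requires. *)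
have /choice[l lP] m : exists l, padic_lim p (fun N => S N.*2 m) l.
  apply: (uc_complete hR) => N; apply: (@coef_divides _ _ (S N.+1.*2 - S N.*2)).
  by apply: tail => //; rewrite leq_double.
have: exists l, padic_lim p S l.
  exists (Fps l) => N; exists N.*2 => n le_n; apply: fps_divides => m.
  have [M lM] := lP m N; have le_M := leq_maxl M N.
  have dl : divides (p ^ N)%:R (S (maxn M N).*2 m - l m) := lM _ le_M.
  have := dividesD (coef_divides m (tail N n (maxn M N).*2 le_n _)) dl.
  rewrite !fpsB addrA subrK; apply.
  by rewrite leq_double leq_maxr.
exact: (@xgetPex _ 0 [set l | padic_lim p S l]%classic).
Qed.

End GroundRing.

(** * The operators delta_q, phi_p and psi_p *)

Section Operators.
Variables (p : nat) (R : idomainType) (k : fieldType).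
Variable red : {rmorphism R -> k}.
Variables (phi : {rmorphism R -> R}) (s : bool).
Hypotheses (hR : unramified_completion p red) (hphi : frobenius_lift p red phi).
Implicit Types (f g h u v : fps R) (nu : {poly {poly R}}) (lambda : {poly R}).

Let p_gt0 : (0 < p)%N := prime_gt0 (uc_prime hR).
Let pchark := residue_pchar hR.
Let phip_mul := phi_p_is_monoid_morphism phi p_gt0.
Local Notation phip := (phi_p p phi).
Local Notation dq := (delta_q s).
Local Notation q := (qn R s).

Lemma phi_qn m : phi (q m) = q m.
Proof. exact: rmorph_int. Qed.

Lemma delta_q_phi_p f : dq (phip f) = p%:R * phip (dq f).
Proof.
apply: fpsP => m; rewrite fps_natM delta_qE !phi_pE.
case: ifP => [/dvdnP[j ->]|]; last by rewrite !mulr0.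
by rewrite mulnK // delta_qE rmorphM phi_qn mulrA mulnC qnM.
Qed.

Lemma fps_natr_neq0 n : (0 < n)%N -> n%:R != 0 :> fps R.
Proof.
move=> n_gt0; apply/eqP => /(congr1 (fun f => f 0%N)).
rewrite -(mulr1 n%:R) fps_natM /= mulr1 => /eqP.
by rewrite (ground_natr_eq0 hR) gtn_eqF.
Qed.

(** The quotient defining [delta_p] is exact because [phi_p u] and u^p have the same reduction mod
    p. *)
Lemma delta_pE u : p%:R * delta_p p phi u = phip u - u ^+ p.
Proof.
apply: quoP; apply: fps_divides => m; apply/(red_eq0P hR).
rewrite -map_fpsE (_ : map_fps red _ = 0) // raddfB /= rmorphXn /=.
by rewrite (map_fps_phi_p _ pchark (fl_red hphi)) subrr.
Qed.

Section UnitSeries.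
Variable u : fps R.
Hypothesis u0 : u 0%N = 1.

Let uU : u \is a GRing.unit := fps_unit1 u0.

Lemma psi_qE : psi_q s u * u = dq u.
Proof. by rewrite divrK. Qed.

Lemma psi_q0 : psi_q s u 0%N = 0.
Proof.
have /(congr1 (fun f : fps R => f 0%N)) := psi_qE.
by rewrite fpsM0 u0 mulr1 delta_q0.
Qed.

Let x := delta_p p phi u / u ^+ p.

Let phipE : phip u = u ^+ p * (1 + p%:R * x).
Proof.
have := delta_pE u; rewrite -(divrK (unitrX p uU) (delta_p p phi u)) -/x.
by move=> E; rewrite -(subrK (u ^+ p) (phip u)) -E; ring.
Qed.

Let x0 : x 0%N = 0.
Proof.
have : (u ^+ p * x * p%:R) 0%N = 0.
  rewrite /x mulrC [u ^+ p * _]mulrC divrK ?unitrX // delta_pE fpsB phi_p0.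
  by rewrite fpsX0 u0 rmorph1 expr1n subrr.
rewrite mulrC fps_natM fpsM0 fpsX0 u0 expr1n mul1r => /eqP.
by rewrite mulf_eq0 (negPf (uc_p_neq0 hR)) => /eqP.
Qed.

Lemma psi_p_lim : padic_lim p
  (fun n => \sum_(i < n) ((-1) ^+ i * quo (p ^ i)%:R i.+1%:R : R) *: x ^+ i.+1)
  (psi_p p phi u).
Proof.
apply: (fps_padic_sum hR) => N n le_N; apply: fps_divides => m.
by apply/dividesMr/dividesMl/(divides_pexp_quo hR).
Qed.

Lemma psi_p0 : psi_p p phi u 0%N = 0.
Proof.
apply: (divides_pexp_eq0 hR) => N; have [M /(_ M (leqnn M))[z]] := psi_p_lim N.
move/(congr1 (fun f => f 0%N)); rewrite fpsB fps_sum fps_natM big1.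
  by move=> E; exists (- z 0%N); rewrite mulrN -E sub0r opprK.
by move=> i _; rewrite /= fpsX0 x0 expr0n mulr0.
Qed.

(* The logarithmic derivative of [phi_p u / u^p = 1 + p x]. *)
Lemma delta_q_psi_p : dq (psi_p p phi u) = phip (psi_q s u) - psi_q s u.
Proof.
set L := psi_p p phi u; set v := psi_q s u; set y := 1 + p%:R * x.
have y_neq0 : y != 0.
  apply/eqP => /(congr1 (fun f => f 0%N)).
  rewrite -[LHS]/((1 : fps R) 0%N + (p%:R * x) 0%N) fps_natM x0 mulr0 addr0.
  by move/eqP; rewrite oner_eq0.
(* Compute delta_q(phi_p u) twice, as p phi_p(v) phi_p(u) and by the product rule on u^p y, then
   cancel p u^p. *)
have dphi : (phip v - v) * y = dq x.
  have upU : u ^+ p \is a GRing.unit by rewrite unitrX.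
  apply: (mulrI upU); apply: (mulfI (fps_natr_neq0 p_gt0)).
  have : p%:R * (phip v * phip u) = dq (phip u).
    by rewrite -phip_mul.2 psi_qE delta_q_phi_p.
  rewrite phipE -/y delta_qM -(prednK p_gt0) delta_qX prednK // -psi_qE -/v.
  have -> : dq y = p%:R * dq x by rewrite raddfD /= delta_q1 add0r delta_q_nat.
  rewrite (_ : u ^+ p.-1 * (v * u) = u ^+ p * v); last first.
    by rewrite mulrCA -exprSr prednK // mulrC.
  set a := u ^+ p; set b := phip v; set c := dq x => E.
  rewrite (_ : p%:R * (a * ((b - v) * y)) = p%:R * (b * (a * y))
    - p%:R * (a * v) * y); last by ring.
  by rewrite E; ring.
(* Differentiation cancels the denominator i + 1 and leaves a geometric series of ratio -p x, whose
   sum is delta_q x / (1 + p x). *)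
have term i : dq (((-1) ^+ i * quo (p ^ i)%:R i.+1%:R : R) *: x ^+ i.+1)
    = (- (p%:R * x)) ^+ i * dq x.
  rewrite delta_qZ delta_qX -mulr_algl 3!mulrA mulr_natr scalerMnl.
  rewrite -mulr_natl mulrCA (pexp_quoE hR) natrX -exprMn mulN1r.
  rewrite -[_%:A]/(in_alg (fps R) _) rmorphXn rmorphN rmorph_nat.
  by rewrite -exprMn mulNr.
apply: (mulIf y_neq0); rewrite dphi; apply: fpsP => m.
(* The equality is checked modulo every p^N, with [L] replaced by a partial sum of length n >= N;
   the remainder of the geometric sum then carries p^n. *)
apply/eqP; rewrite -subr_eq0; apply/eqP.
apply: (divides_pexp_eq0 hR) => N; rewrite -fpsB; apply: coef_divides.
have [M SM] := psi_p_lim N; have [z] := SM (maxn M N) (leq_maxl M N).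
set n := maxn M N; rewrite -/L; set S := \sum_(i < n) _ => SE.
have dS : dq S * y = dq x - (- (p%:R * x)) ^+ n * dq x.
  rewrite /S raddf_sum /=; under eq_bigr do rewrite term.
  rewrite -mulr_suml.
  have := subrX1 (- (p%:R * x)) n; set t := _ ^+ n; set b := \sum_(i < n) _.
  by move=> E; rewrite -[in RHS](subrK 1 t) E /y; ring.
have -> : dq L * y - dq x
    = - ((p ^ N)%:R * (dq z * y) + (- (p%:R * x)) ^+ n * dq x).
  have -> : dq L = dq S - (p ^ N)%:R * dq z.
    by rewrite -delta_q_nat -SE raddfB /= opprB addrC subrK.
  by rewrite mulrBl dS; ring.
apply/dividesN/dividesD; first exact/dividesMr/divides_refl.
apply/dividesMr; rewrite -mulNr exprMn; apply/dividesMr.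
rewrite -mulN1r exprMn -natrX; apply/dividesMl/divides_exp.
exact: leq_maxr.
Qed.

End UnitSeries.
End Operators.

(** The last hypothesis covers an empty sum, which occurs when the index runs over the size of the
    zero polynomial. *)
Lemma sum_head (A : nmodType) n (F : nat -> A) :
    (forall i, (0 < i)%N -> F i = 0) -> (n = 0%N -> F 0%N = 0) ->
  \sum_(i < n) F i = F 0%N.
Proof.
case: n => [_ /(_ erefl) -> | n F0 _]; first by rewrite big_ord0.
by rewrite big_ord_recl big1 ?addr0 // => i _; apply: F0.
Qed.

Lemma nth_size0 (A : nzSemiRingType) (P : {poly A}) : size P = 0%N -> P`_0 = 0.
Proof. by move/eqP; rewrite size_poly_eq0 => /eqP ->; rewrite coef0. Qed.

(** * The linear equation satisfied by the logarithmic derivative *)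

Section LinearEquation.
Variables (p : nat) (R : idomainType) (k : fieldType).
Variable red : {rmorphism R -> k}.
Variables (phi : {rmorphism R -> R}) (s : bool).
Hypotheses (hR : unramified_completion p red) (hphi : frobenius_lift p red phi).
Variables (nu : {poly {poly R}}) (lambda : {poly R}).
Implicit Types (f g h u v w : fps R).

Let p_gt0 : (0 < p)%N := prime_gt0 (uc_prime hR).
Local Notation phip := (phi_p p phi).
Local Notation dq := (delta_q s).
Local Notation q := (qn R s).

(* [lambda_twist] is lambda(p phi_p). *)
Definition lambda_twist h : fps R :=
  \sum_(i < size lambda) (lambda`_i * (p ^ i)%:R) *: iter i phip h.

(* [mu_op] is mu(phi_p, delta_q): [delta_q (psi_m u) = mu_op (psi_q u)]. *)
Definition mu_op v : fps R :=
  dq (nu_op p phi s nu v) + lambda_twist (phip v - v).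

(** This is mu(0, n) at the exponent n = [qexp s m]: setting xi_p = 0 leaves nu(0, n) n -
    lambda(0). *)
Definition mu_diag m : R := (nu`_0).[q m] * q m - lambda`_0.

Lemma mu0E m : mu0 (char_poly2 p nu lambda) (qexp s m)%:~R = mu_diag m.
Proof.
have pX0 (A : comNzRingType) (P : {poly A}) :
    (P \Po (p%:R *: 'X)).[0] = P`_0.
  by rewrite horner_comp hornerZ hornerX mulr0 horner_coef0.
rewrite /mu0 (_ : _.[0] = nu`_0 * 'X - (lambda`_0)%:P); last first.
  rewrite /char_poly2 hornerD !hornerM pX0 hornerC; congr (_ + _).
  rewrite hornerD hornerX hornerN hornerC add0r mulrN1.
  by rewrite horner_coef0 coef_map -horner_coef0 pX0.
by rewrite hornerD hornerM hornerN hornerX hornerC.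
Qed.

Lemma iter_phi0 i : iter i phi 0 = 0.
Proof. by elim: i => // i IHi; rewrite iterS IHi rmorph0. Qed.

Lemma iter_delta_qE j v m : iter j dq v m = q m ^+ j * v m.
Proof.
by elim: j => [|j IHj]; rewrite ?mul1r // iterS delta_qE IHj exprS mulrA.
Qed.

Lemma delta_q_iter_phi_p i f :
  dq (iter i phip f) = (p ^ i)%:R * iter i phip (dq f).
Proof.
elim: i => [|i IHi]; first by rewrite mul1r.
rewrite !iterS (delta_q_phi_p _ _ hR) IHi expnS natrM -mulrA; congr (_ * _).
rewrite !mulr_natl; pose phia : {additive fps R -> fps R} := phip.
exact: (raddfMn phia).
Qed.

Lemma delta_q_lambda_op f :
  dq (lambda_op p phi lambda f) = lambda_twist (dq f).
Proof.
rewrite /lambda_op /lambda_twist raddf_sum /=; apply: eq_bigr => i _.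
rewrite delta_qZ delta_q_iter_phi_p -scalerA; congr (_ *: _).
by apply: fpsP => m; rewrite fps_natM.
Qed.

Lemma delta_q_psi_m u : u 0%N = 1 ->
  dq (psi_m p phi s nu lambda u) = mu_op (psi_q s u).
Proof.
move=> u0; rewrite /psi_m raddfD /= delta_q_lambda_op.
by rewrite (delta_q_psi_p s hR hphi u0).
Qed.

Lemma psi_m0 u : u 0%N = 1 -> psi_m p phi s nu lambda u 0%N = 0.
Proof.
move=> u0; rewrite -[LHS]/((nu_op _ _ _ _ _) 0%N + (lambda_op _ _ _ _) 0%N).
rewrite /nu_op /lambda_op !fps_sum !big1 ?addr0 // => i _.
  rewrite /= iter_phi_pE // dvdn0 div0n (psi_p0 hR hphi u0) iter_phi0.
  by rewrite mulr0.
rewrite fps_sum big1 // => j _.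
rewrite /= iter_phi_pE // dvdn0 div0n iter_delta_qE (psi_q0 s u0) mulr0.
by rewrite iter_phi0 mulr0.
Qed.

Lemma delta_q_inj f g : f 0%N = g 0%N -> dq f = dq g -> f = g.
Proof.
move=> eq0 eqd; apply: fpsP => -[//|m].
have /eqP := congr1 (fun h : fps R => h m.+1) eqd.
rewrite !delta_qE -subr_eq0 -mulrBr mulf_eq0 (qn_eq0 hR) subr_eq0.
by move=> /= /eqP.
Qed.

(** Both sides of the nonlinear equation have zero constant term, and [delta_q] is injective on such
    series, so passing to the linear equation loses nothing. *)
Lemma psi_m_eqP u f : u 0%N = 1 -> f 0%N = 0 ->
  psi_m p phi s nu lambda u = f <-> mu_op (psi_q s u) = dq f.
Proof.
move=> u0 f0; rewrite -delta_q_psi_m //; split=> [-> //|].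
by apply: delta_q_inj; rewrite psi_m0.
Qed.

Lemma mu_op_is_zmod_morphism : zmod_morphism mu_op.
Proof.
pose phia : {additive fps R -> fps R} := phip.
have iterB (h : {additive fps R -> fps R}) i f g :
    iter i h (f - g) = iter i h f - iter i h g.
  by elim: i => // i IHi; rewrite !iterS IHi raddfB.
move=> v w; rewrite /mu_op.
have -> : nu_op p phi s nu (v - w) = nu_op p phi s nu v - nu_op p phi s nu w.
  rewrite /nu_op -sumrB; apply: eq_bigr => i _.
  rewrite -sumrB; apply: eq_bigr => j _.
  by rewrite (iterB (@delta_q R s)) (iterB phia) scalerBr.
have twistB f g : lambda_twist (f - g) = lambda_twist f - lambda_twist g.
  rewrite /lambda_twist -sumrB; apply: eq_bigr => i _.
  by rewrite (iterB phia) scalerBr.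
rewrite (raddfB phia) raddfB /= !twistB; set a := dq _; set b := dq _.
by set c := lambda_twist _; set d := lambda_twist _; ring.
Qed.

HB.instance Definition _ := GRing.isZmodMorphism.Build (fps R) (fps R)
  mu_op mu_op_is_zmod_morphism.

(** Triangularity: a power phi_p^i with i >= 1 contributes at [m] only through the coefficient at m
    / p^i. When these vanish, only the part of mu free of xi_p acts. *)
Lemma mu_op_diag v m :
    (forall i, (0 < i)%N -> (p ^ i %| m)%N -> v (m %/ p ^ i)%N = 0) ->
  mu_op v m = mu_diag m * v m.
Proof.
move=> v0; rewrite -[LHS]/((dq _) m + (lambda_twist _) m) delta_qE.
have -> : nu_op p phi s nu v m = (nu`_0).[q m] * v m.
  pose F i := \sum_(j < size nu`_i)
    nu`_i`_j * iter i phip (iter j dq v) m.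
  transitivity (\sum_(i < size nu) F i).
    by rewrite /nu_op fps_sum; apply: eq_bigr => i _; rewrite fps_sum.
  rewrite sum_head /F.
  - rewrite horner_coef mulr_suml; apply: eq_bigr => j _.
    by rewrite iter_delta_qE mulrA.
  - move=> i i_gt0; apply: big1 => j _; rewrite iter_phi_pE //.
    case: ifP => [pm|_]; last by rewrite mulr0.
    by rewrite iter_delta_qE v0 // mulr0 iter_phi0 mulr0.
  - by move=> /nth_size0 ->; rewrite size_poly0 big_ord0.
have -> : lambda_twist (phip v - v) m = - lambda`_0 * v m.
  pose F i := lambda`_i * (p ^ i)%:R * iter i phip (phip v - v) m.
  transitivity (\sum_(i < size lambda) F i).
    by rewrite /lambda_twist fps_sum.
  rewrite sum_head /F.
  - rewrite expn0 mulr1 fpsB phi_pE; case: ifP => pm.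
      by rewrite -[p in (m %/ p)%N]expn1 v0 ?expn1 // rmorph0 sub0r mulrN mulNr.
    by rewrite sub0r mulrN mulNr.
  - move=> i i_gt0; rewrite iter_phi_pE //.
    case: ifP => [pm|_]; last by rewrite mulr0.
    rewrite fpsB (v0 i) // subr0 phi_pE; case: ifP => ppm; last first.
      by rewrite iter_phi0 mulr0.
    rewrite -divnMA -expnSr v0 ?rmorph0 ?iter_phi0 ?mulr0 //.
    by rewrite expnS -(divnK pm) dvdn_pmul2r ?expn_gt0 ?p_gt0.
  - by move=> /nth_size0 ->; rewrite !mul0r.
by rewrite mulrA [q m * _]mulrC -mulrDl.
Qed.

End LinearEquation.

(** * Solving the equation *)

Section Dwork.
Variables (p : nat) (R : idomainType) (k : fieldType).
Variable red : {rmorphism R -> k}.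
Variables (phi : {rmorphism R -> R}) (s : bool).
Hypotheses (hR : unramified_completion p red) (hphi : frobenius_lift p red phi).
Implicit Types (f g h u v w : fps R).

Let p_prime := uc_prime hR.
Local Notation phip := (phi_p p phi).
Local Notation dq := (delta_q s).
Local Notation q := (qn R s).

Lemma divides_qn m (x : R) : divides (q m) x <-> divides m%:R x.
Proof.
have sgn2 : (-1) ^+ s * (-1) ^+ s = 1 :> R by rewrite -expr2 sqrr_sign.
split=> [[z ->]|[z ->]]; exists ((-1) ^+ s * z).
  by rewrite qnE -mulrA mulrCA.
by rewrite qnE mulrACA sgn2 mul1r.
Qed.

(** The equation determines the coefficients of u recursively, and the issue is whether each
    division by the exponent is exact. Since [quo] always has a value, u exists as a series from the
    outset, and the induction may compare v with the actual logarithmic derivative of u. *)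
Lemma dwork v : v 0%N = 0 -> (forall m, divides m%:R ((phip v - v) m)) ->
  exists2 u : fps R, u 0%N = 1 & dq u = v * u.
Proof.
move=> v0 dv.
pose cut m (a : nat -> R) := Fps (fun j => if (j < m)%N then a j else 0).
pose F m (a : nat -> R) := if m == 0%N then 1 else quo ((v * cut m a) m) (q m).
have [m a b eqab|u uE] := fps_rec (F := F).
  rewrite /F; congr (if _ then _ else quo ((v * _) m) _); apply: fpsP => j /=.
  by case: ifP => // /eqab.
have u0 : u 0%N = 1 by rewrite uE.
exists u => //; apply: fpsP; elim/ltn_ind => -[|m] IHm.
  by rewrite delta_q0 fpsM0 v0 mul0r.
have cutE : (v * cut m.+1 u) m.+1 = (v * u) m.+1.
  rewrite !fpsM; apply: eq_bigr => -[[|i] lti] _ /=; first by rewrite v0 !mul0r.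
  by rewrite ltnS subSS leq_subr.
have um : u m.+1 = quo ((v * u) m.+1) (q m.+1) by rewrite -cutE uE.
rewrite delta_qE um; apply: quoP; apply/divides_qn.
(* By induction r agrees with v below the current index. It also satisfies the congruences assumed
   of v, because phi_p r - r = delta_q(psi_p u). *)
set r := psi_q s u; set w := v - r.
have ru : r * u = dq u := psi_qE s u0.
have w0 j : (j < m.+1)%N -> w j = 0.
  move=> ltj; rewrite -[w](mulrK (fps_unit1 u0)).
  rewrite (@fpsM_local _ _ 0 _ u^-1) ?mul0r // => i lei.
  by rewrite mulrBl fpsB ru IHm ?subrr // (leq_ltn_trans lei).
have wE j : w j = v j - r j by [].
have vE : v = r + w by rewrite /w addrC subrK.
clearbody w; have -> : (v * u) m.+1 = dq u m.+1 + w m.+1.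
  rewrite vE mulrDl ru; congr (_ + _).
  rewrite fpsM big_ord_recr big1 /= => [|i _]; last by rewrite w0 ?mul0r.
  by rewrite add0r subnn u0 mulr1.
apply: dividesD; first by apply/divides_qn/dividesMr/divides_refl.
have dr : divides m.+1%:R ((phip r - r) m.+1).
  rewrite -(delta_q_psi_p s hR hphi u0).
  by apply/divides_qn/dividesMr/divides_refl.
(* The [phi_p] terms of v and r agree here, since they involve a strictly smaller index; the
   discrepancy w is thus a difference of two multiples of m + 1. *)
suff -> : w m.+1 = (phip r - r) m.+1 - (phip v - v) m.+1 by apply: dividesB.
have eqp : phip v m.+1 = phip r m.+1.
  apply/eqP; rewrite -subr_eq0 !phi_pE; case: ifP => _; last by rewrite subrr.
  by rewrite -rmorphB -wE w0 ?rmorph0 // ltn_Pdiv // prime_gt1.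
by rewrite !fpsB wE eqp; ring.
Qed.

(** The quotient u' / u has zero derivative and constant term 1, hence equals 1. *)
Lemma psi_q_inj u u' : u 0%N = 1 -> u' 0%N = 1 -> psi_q s u = psi_q s u' ->
  u = u'.
Proof.
move=> u0 u0' eqv; have uU := fps_unit1 u0; pose w := u' / u.
have wE : u' = w * u by rewrite divrK.
have w0 : w 0%N = (1 : fps R) 0%N.
  by move: u0'; rewrite wE fpsM0 u0 mulr1.
suff w1 : w = 1 by rewrite wE w1 mul1r.
apply: (delta_q_inj (s := s) hR w0); rewrite delta_q1.
apply: (mulIr uU); rewrite mul0r.
have := psi_qE s u0'; rewrite -eqv wE delta_qM -(psi_qE s u0).
by rewrite mulrCA => /esym/eqP; rewrite -subr_eq0 addrK => /eqP.
Qed.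

End Dwork.

(** * Existence and uniqueness of the solution *)

Section Solving.
Variables (p : nat) (R : idomainType) (k : fieldType).
Variable red : {rmorphism R -> k}.
Variables (phi : {rmorphism R -> R}) (s : bool).
Hypotheses (hR : unramified_completion p red) (hphi : frobenius_lift p red phi).
Variables (nu : {poly {poly R}}) (lambda : {poly R}).
Hypothesis hnd : nondeg_char (char_poly2 p nu lambda).
Implicit Types (f g h u v w : fps R).

Let p_prime := uc_prime hR.
Let p_gt0 : (0 < p)%N := prime_gt0 p_prime.
Local Notation phip := (phi_p p phi).
Local Notation dq := (delta_q s).
Local Notation q := (qn R s).
Local Notation mu_op := (mu_op p phi s nu lambda).
Local Notation mu_diag := (mu_diag s nu lambda).

Let div_pexp_lt i m : (0 < i)%N -> (0 < m)%N -> (m %/ p ^ i < m)%N.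
Proof.
by move=> i_gt0 m_gt0; rewrite ltn_Pdiv // -(expn0 p) ltn_exp2l ?prime_gt1.
Qed.

Lemma lambda0_unit : lambda`_0 \is a GRing.unit.
Proof.
have := hnd; rewrite /nondeg_char.
have := mu0E p s nu lambda 0; rewrite -/(qn R s 0) qn0 => ->.
by rewrite /(mu_diag) qn0 mulr0 sub0r unitrN.
Qed.

(** When p divides the exponent n, mu(0, n) is congruent to mu(0, 0) = -lambda(0), a unit. *)
Lemma mu_diag_unit m : (p %| m)%N -> mu_diag m \is a GRing.unit.
Proof.
move=> pm; apply: (unit_of_red hR).
have rq : red (q m) = 0.
  rewrite qnE rmorphM rmorph_nat; apply/eqP; rewrite mulf_eq0.
  by rewrite -(dvdn_pcharf (residue_pchar hR)) pm orbT.
rewrite /(mu_diag) rmorphB rmorphM rq mulr0 sub0r oppr_eq0.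
by rewrite -unitfE rmorph_unit // lambda0_unit.
Qed.

Definition totally_nonchar f :=
  forall m, f m != 0 -> ~~ (p %| m)%N /\ mu_diag m \is a GRing.unit.

Lemma totally_noncharP f :
  (supp s f `<=` totally_nonchar_ints p red (char_poly2 p nu lambda))%classic ->
  totally_nonchar f.
Proof.
move=> hf m fm; have [|pm] := hf (qexp s m); first by exists m.
rewrite mu0E => /(unit_of_red hR) ?; split=> //.
by move: pm; rewrite dvdzE /qexp abszM abszX exp1n mul1n.
Qed.

(** The triangular system is solved coefficient by coefficient. Where the diagonal is not a unit,
    [m] is prime to p and f vanishes at [m]; no lower coefficient enters that equation, so v can be
    0 there. *)
Lemma linear_solution f : totally_nonchar f ->
  exists v, [/\ v 0%N = 0, mu_op v = dq f
    & forall m, mu_diag m = 0 -> v m = 0].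
Proof.
move=> hf.
pose cut m (a : nat -> R) := Fps (fun j => if (j < m)%N then a j else 0).
(* The value 1 is a placeholder for non-unit diagonals, where the numerator computed from the
   solution is 0. *)
pose c m := if mu_diag m \is a GRing.unit then mu_diag m else 1.
pose F m (a : nat -> R) :=
  if m == 0%N then 0 else (q m * f m - mu_op (cut m a) m) / c m.
have cU m : c m \is a GRing.unit.
  by rewrite /c; case: ifP => // _; apply: unitr1.
have [m a b eqab|v vE] := fps_rec (F := F).
  rewrite /F; congr (if _ then _ else (_ - mu_op _ m) / _).
  by apply: fpsP => j /=; case: ifP => // /eqab.
have v0 : v 0%N = 0 by rewrite vE.
have vN m : mu_diag m \isn't a GRing.unit -> v m = 0.
  move=> cN; case: (posnP m) => [->//|m_gt0].
  have pm : ~~ (p %| m)%N by apply: contra cN => /mu_diag_unit.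
  have fm : f m = 0 by apply/eqP; apply: contraR cN => /hf[].
  rewrite vE /F gtn_eqF // fm mulr0.
  rewrite (mu_op_diag phi s hR nu lambda) => [|i i_gt0 pim].
    by rewrite /= ltnn mulr0 subr0 mul0r.
  by case/negP: pm; apply: dvdn_trans pim; apply: dvdn_exp.
exists v; split=> // [|m c0]; last by apply: vN; rewrite c0 unitr0.
apply: fpsP => -[|m].
  rewrite (mu_op_diag phi s hR nu lambda) ?v0 ?mulr0 ?delta_q0 // => i _ _.
  by rewrite div0n.
(* The part of v from index m + 1 on has no smaller coefficients, so only the diagonal acts on it at
   that index. *)
have -> : v = cut m.+1 v + (v - cut m.+1 v) by rewrite addrC subrK.
have wE j : (v - cut m.+1 v) j = if (j < m.+1)%N then 0 else v j.
  by rewrite fpsB /=; case: ifP => _; rewrite ?subrr ?subr0.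
rewrite raddfD -[LHS]/(_ + mu_op _ _).
rewrite (mu_op_diag phi s hR nu lambda) => [|i i_gt0 pim].
  rewrite wE ltnn delta_qE (_ : mu_diag m.+1 * v m.+1 = c m.+1 * v m.+1).
    by rewrite {1}vE /F /= [c _ * _]mulrC divrK // addrC subrK.
  by rewrite /c; case: ifPn => // /vN ->; rewrite !mulr0.
by rewrite wE div_pexp_lt.
Qed.

(** If v vanishes at all m / p^i with i >= 1 and f vanishes at [m], the equation reduces to mu(0, n)
    v_m = 0; at a characteristic integer v_m = 0 holds by assumption. *)
Lemma linear_solution_supp f v m :
    v 0%N = 0 -> mu_op v = dq f -> (forall m, mu_diag m = 0 -> v m = 0) ->
  v m != 0 -> exists2 i, (p ^ i %| m)%N & f (m %/ p ^ i)%N != 0.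
Proof.
move=> v0 vE vK; elim/ltn_ind: m => m IHm vm.
have m_gt0 : (0 < m)%N by case: m vm {IHm} => //; rewrite v0 eqxx.
case: (pselect (exists i,
    [/\ (0 < i)%N, (p ^ i %| m)%N & v (m %/ p ^ i)%N != 0])).
  move=> [i [i_gt0 pim /IHm[|j pj fj]]]; first exact: div_pexp_lt.
  exists (i + j)%N; last by rewrite expnD divnMA.
  by rewrite expnD -(divnK pim) mulnC dvdn_pmul2r ?expn_gt0 ?p_gt0.
move=> vi; exists 0%N; first exact: dvd1n.
rewrite expn0 divn1; apply: contraNneq vm => fm.
have : mu_op v m = 0 by rewrite vE delta_qE fm mulr0.
rewrite (mu_op_diag phi s hR nu lambda) => [/eqP|i i_gt0 pim].
  by rewrite mulf_eq0 => /orP[/eqP/vK ->|].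
by apply/eqP/negP => /negP vpi; case: vi; exists i.
Qed.

Lemma linear_solution_uniq v w :
    v 0%N = 0 -> w 0%N = 0 -> mu_op v = mu_op w ->
    (forall m, mu_diag m = 0 -> v m = 0) ->
    (forall m, mu_diag m = 0 -> w m = 0) ->
  v = w.
Proof.
move=> v0 w0 eqvw vK wK; apply: fpsP => m; apply/eqP; rewrite -subr_eq0 -fpsB.
(* The difference solves the homogeneous equation, so its support comes from that of the zero
   series. *)
apply/negP => /negP; case/(@linear_solution_supp 0) => [|||i _ /=].
- by rewrite fpsB v0 w0 subrr.
- by rewrite raddfB /= eqvw subrr raddf0.
- by move=> j cj; rewrite fpsB vK ?wK ?subrr.
- by rewrite eqxx.
Qed.

(** With h = phi_p v - v, the series lambda(p phi_p) h is a [delta_q]-derivative, so [m] divides its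
    coefficient at [m]. By induction [m] divides the terms p^i phi^i(h(m / p^i)) with i >= 1. What
    remains is lambda(0) h_m, and lambda(0) is a unit. *)
Lemma linear_solution_congr f v : v 0%N = 0 -> mu_op v = dq f ->
  forall m, divides m%:R ((phip v - v) m).
Proof.
move=> v0 vE; set h := phip v - v.
have h0 : h 0%N = 0 by rewrite /h fpsB phi_p0 v0 rmorph0 subrr.
have twE : lambda_twist p phi lambda h = dq (f - nu_op p phi s nu v).
  by rewrite raddfB /= -vE /(mu_op) -/h addrAC subrr add0r.
clearbody h; elim/ltn_ind => m IHm.
case: (posnP m) => [->|m_gt0]; first by rewrite h0; apply: divides0.
have tw : divides m%:R (lambda_twist p phi lambda h m).
  by rewrite twE; apply/(divides_qn s)/dividesMr/divides_refl.
suff : divides m%:R (lambda`_0 * h m).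
  by move/(dividesMl (lambda`_0)^-1); rewrite mulKr ?lambda0_unit.
pose F i := lambda`_i * (p ^ i)%:R * iter i phip h m.
have {}twE : lambda_twist p phi lambda h m = \sum_(i < size lambda) F i.
  by rewrite /lambda_twist fps_sum.
have F0 : F 0%N = lambda`_0 * h m by rewrite /F expn0 mulr1.
have dF i : divides m%:R (F i.+1).
  rewrite /F iter_phi_pE //; case: ifP => [pim|_]; last first.
    by rewrite mulr0; apply: divides0.
  rewrite -mulrA; apply: dividesMl.
  have [z ->] := IHm _ (div_pexp_lt (ltn0Sn i) m_gt0).
  exists (iter i.+1 phi z).
  have iterM j n : iter j phi (n%:R * z) = n%:R * iter j phi z.
    by elim: j => // j IHj; rewrite !iterS IHj rmorphM rmorph_nat.
  rewrite iterM.
  by rewrite mulrA -natrM mulnC divnK.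
move: tw; rewrite twE; case E: (size lambda) => [|n].
  by rewrite (nth_size0 E) mul0r => _; apply: divides0.
rewrite big_ord_recl F0 => /dividesB dy.
rewrite -(addrK (\sum_(i < n) F i.+1) (_ * _)).
by apply/dy/divides_sum => i _; apply: dF.
Qed.

Lemma is_solutionP f u : f 0%N = 0 ->
  is_solution p phi s nu lambda f u <->
  [/\ u 0%N = 1, mu_op (psi_q s u) = dq f
    & forall m, mu_diag m = 0 -> psi_q s u m = 0].
Proof.
move=> f0; have charE m :
    char_ints (char_poly2 p nu lambda) (qexp s m) <-> mu_diag m = 0.
  by rewrite /char_ints /= mu0E.
split=> [[u0 /(psi_m_eqP s hR hphi nu lambda u0 f0) uE uK]|[u0 uE uK]].
  split=> // m /charE cm; apply: contrapT => /eqP um.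
  suff : (set0 : set int) (qexp s m) by [].
  by rewrite -uK; split=> //; exists m.
split=> //; first exact/(psi_m_eqP s hR hphi nu lambda u0 f0).
apply/seteqP; split=> // _ [[m -> um] /charE /uK /eqP].
by rewrite (negPf um).
Qed.

Lemma solution_exists f : f 0%N = 0 -> totally_nonchar f ->
  exists u, is_solution p phi s nu lambda f u.
Proof.
move=> f0 /linear_solution[v [v0 vE vK]].
have [u u0 uE] := dwork s hR hphi v0 (linear_solution_congr v0 vE).
exists u; apply/is_solutionP => //.
have -> : psi_q s u = v by rewrite /psi_q uE mulrK // fps_unit1.
by [].
Qed.

Lemma solution_unique f u u' : f 0%N = 0 ->
    is_solution p phi s nu lambda f u -> is_solution p phi s nu lambda f u' ->
  u = u'.
Proof.
move=> f0 /(is_solutionP _ f0)[u0 uE uK] /(is_solutionP _ f0)[u0' uE' uK'].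
have eqE : mu_op (psi_q s u) = mu_op (psi_q s u') by rewrite uE uE'.
apply: (psi_q_inj hR u0 u0').
exact: (linear_solution_uniq (psi_q0 s u0) (psi_q0 s u0') eqE uK uK').
Qed.

End Solving.

(** * Algebraic elements over a field of rational functions *)

Section Fractions.
Variable D : idomainType.
Local Notation tofrac := (@FracField.tofrac D).
Local Notation "x %:F" := (@FracField.tofrac D x).

Lemma frac_numden (x : {fraction D}) :
  x * (\d_(generic_quotient.repr x))%:F = (\n_(generic_quotient.repr x))%:F.
Proof.
rewrite -{1}[x](@generic_quotient.reprK _ (FracField.type D)).
unlock tofrac; rewrite -[LHS]FracField.pi_mul; apply/generic_quotient.eqmodP.
rewrite /= FracField.equivfE /FracField.mulf /=.
by rewrite !numden_Ratio ?oner_neq0 ?mulr1 ?denom_ratioP // mulrC.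
Qed.

Lemma fracP (x : {fraction D}) : exists a b, b != 0 /\ x * b%:F = a%:F.
Proof.
exists \n_(generic_quotient.repr x), \d_(generic_quotient.repr x).
by rewrite frac_numden denom_ratioP.
Qed.

Lemma frac_poly_clear (P : {poly {fraction D}}) :
  exists c (Q : {poly D}), c != 0 /\ c%:F *: P = map_poly tofrac Q.
Proof.
elim/poly_ind: P => [|P x [c [Q [c0 PQ]]]].
  by exists 1, 0; rewrite oner_neq0 scaler0 rmorph0.
have [a [b [b0 xab]]] := fracP x.
exists (b * c), ((b *: Q) * 'X + (c * a)%:P); split; first by rewrite mulf_neq0.
have -> : map_poly tofrac ((b *: Q) * 'X + (c * a)%:P)
    = (b%:F *: map_poly tofrac Q) * 'X + ((c * a)%:F)%:P.
  by rewrite rmorphD rmorphM /= map_polyX map_polyC map_polyZ.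
rewrite -PQ scalerDr !scalerA -!scalerAl -!tofracM; congr (_ + _).
by rewrite -mul_polyC -polyCM !tofracM -xab; congr (_%:P); ring.
Qed.

End Fractions.

(** * The embedding of rational functions into Laurent series *)

Section Ratl.
Variable F : fieldType.
Local Notation K := {fraction {poly F}}.
Local Notation E := {fraction fps F}.

Definition poly_frac (P : {poly F}) : E := FracField.tofrac (fps_of_poly P).

HB.instance Definition _ := GRing.RMorphism.copy poly_frac
  (@FracField.tofrac (fps F) \o @fps_of_poly F).

Lemma poly_frac_eq0 P : (poly_frac P == 0) = (P == 0).
Proof.
rewrite /poly_frac tofrac_eq0; apply/eqP/eqP=> [|->]; last exact: rmorph0.
by rewrite -(rmorph0 (@fps_of_poly F)) => /fps_of_poly_inj.
Qed.

(** [ratl] is computed from a chosen representative; cross-multiplication shows that every fraction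
    representing x gives the same value. *)
Lemma ratlP (x : K) (a b : {poly F}) : b != 0 ->
    x * FracField.tofrac b = FracField.tofrac a ->
  ratl x * poly_frac b = poly_frac a.
Proof.
move=> b0 xab; have := frac_numden x; rewrite /ratl.
set n := \n__; set d := \d__ => xnd; rewrite -!/(poly_frac _).
have d0 : d != 0 by apply: denom_ratioP.
have : n * b = a * d.
  apply/eqP; rewrite -tofrac_eq !tofracM -xnd -xab; apply/eqP.
  by rewrite mulrAC.
move/(congr1 poly_frac); rewrite !rmorphM => nbad.
by rewrite mulrAC nbad mulfK // poly_frac_eq0.
Qed.

Lemma ratl_frac (a : {poly F}) : ratl (FracField.tofrac a) = poly_frac a.
Proof.
have := @ratlP (FracField.tofrac a) a 1; rewrite oner_neq0 !rmorph1 !mulr1.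
exact.
Qed.

Lemma ratl_is_zmod_morphism : zmod_morphism (@ratl F).
Proof.
move=> x y; have [a [b [b0 xab]]] := fracP x; have [c [d [d0 ycd]]] := fracP y.
have bd0 : b * d != 0 by rewrite mulf_neq0.
have /(ratlP bd0) : (x - y) * FracField.tofrac (b * d)
    = FracField.tofrac (a * d - c * b).
  by rewrite rmorphB !rmorphM /= -xab -ycd; ring.
rewrite rmorphB !rmorphM /= -(ratlP b0 xab) -(ratlP d0 ycd) => E.
apply: (mulIf (_ : poly_frac b * poly_frac d != 0)).
  by rewrite mulf_neq0 ?poly_frac_eq0.
by rewrite E; ring.
Qed.

Lemma ratl_is_monoid_morphism : monoid_morphism (@ratl F).
Proof.
split=> [|x y].
  by rewrite -(rmorph1 (@FracField.tofrac {poly F})) ratl_frac rmorph1.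
have [a [b [b0 xab]]] := fracP x; have [c [d [d0 ycd]]] := fracP y.
have bd0 : b * d != 0 by rewrite mulf_neq0.
have /(ratlP bd0) : (x * y) * FracField.tofrac (b * d)
    = FracField.tofrac (a * c).
  by rewrite !rmorphM /= -xab -ycd; ring.
rewrite !rmorphM /= -(ratlP b0 xab) -(ratlP d0 ycd) => E.
apply: (mulIf (_ : poly_frac b * poly_frac d != 0)).
  by rewrite mulf_neq0 ?poly_frac_eq0.
by rewrite E; ring.
Qed.

HB.instance Definition _ := GRing.isZmodMorphism.Build K E
  (@ratl F) ratl_is_zmod_morphism.
HB.instance Definition _ := GRing.isMonoidMorphism.Build K E
  (@ratl F) ratl_is_monoid_morphism.

End Ratl.

(** An annihilating polynomial of least size is irreducible, and the quotient by it embeds in [E] by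
    sending the class of the variable to z. *)
Lemma algebraic_extension (F E : fieldType) (iota : {rmorphism F -> E})
    (z : E) :
    algebraicOver iota z ->
  exists (L : fieldExtType F) (g : {rmorphism L -> E}) (y : L),
    [/\ forall a : F, g a%:A = iota a, g y = z & <<1; y>>%VS = {:L}%VS].
Proof.
move=> [P0 P0n P0z].
pose good n := `[< exists P : {poly F},
  [/\ P != 0, root (map_poly iota P) z & size P = n] >].
have ex_good : exists n, good n by exists (size P0); apply/asboolP; exists P0.
case: (ex_minnP ex_good) => n /asboolP[P [P_neq0 Pz sP]] Pmin.
have minP (Q : {poly F}) :
    Q != 0 -> root (map_poly iota Q) z -> (n <= size Q)%N.
  by move=> Q0 Qz; apply: Pmin; apply/asboolP; exists Q.
have irrP : irreducible_poly P.
  apply/(subfx_irreducibleP Pz P_neq0) => Q Qz Q0.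
  by rewrite sP; apply: minP.
pose L := SubFieldExtType Pz irrP.
exists L, (@subfx_inj F E iota z P : {rmorphism L -> E}).
exists (@subfx_root F E iota z P).
split.
- by move=> a; apply: subfx_inj_base.
- exact: subfx_inj_root.
apply/vspaceP => x; rewrite memvf.
have [Q ->] := subfxEroot Pz P_neq0 x.
apply/Fadjoin_polyP; exists (map_poly (in_alg L) Q) => //.
by apply/polyOver1P; exists Q.
Qed.

(** * Artin-Schreier extensions *)

Section ArtinSchreier.
Variables (p : nat) (F : fieldType) (a : F).
Hypothesis pcharF : p \in [pchar F].

Let p_prime := pcharf_prime pcharF.
Let p_gt1 := prime_gt1 p_prime.

Section Roots.
Variables (L : fieldExtType F) (y : L).
Hypotheses (yE : y ^+ p - y = a%:A) (y_gen : <<1; y>>%VS = {:L}%VS).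

Let pcharL : p \in [pchar L] := rmorph_pchar (in_alg L) pcharF.

Definition AS_roots : seq L := [seq y + i%:R | i <- iota 0 p].
Definition AS_poly : {poly L} := 'X^p - ('X + (a%:A)%:P).

Lemma AS_roots_uniq : uniq AS_roots.
Proof.
have lem i j : (i <= j)%N -> (j < p)%N -> i%:R = j%:R :> L -> i = j.
  move=> le_ij lt_jp /eqP; rewrite eq_sym -subr_eq0 -natrB //.
  rewrite -(dvdn_pcharf pcharL) => pij.
  by case: (posnP (j - i)) => [|/dvdn_leq/(_ pij)]; lia.
rewrite map_inj_in_uniq ?iota_uniq // => i j.
rewrite !mem_iota !add0n => /= lti ltj /addrI eqij.
by case: (leqP i j) => [|/ltnW] le; [|symmetry]; apply: lem.
Qed.

(** Since (y + i)^p = y^p + i in characteristic p, the p distinct translates of y by the prime field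
    are all the roots. *)
Lemma AS_polyE : AS_poly = \prod_(z <- AS_roots) ('X - z%:P).
Proof.
have sz : (size ('X + (a%:A)%:P : {poly L})%R < size ('X^p : {poly L})%R)%N.
  by rewrite size_XaddC size_polyXn.
rewrite [LHS](@all_roots_prod_XsubC _ _ AS_roots).
- by rewrite lead_coefDl ?size_polyN // lead_coefXn scale1r.
- by rewrite size_polyDl ?size_polyN // size_polyXn size_map size_iota.
- apply/allP => _ /mapP[i _ ->]; rewrite rootE !hornerE.
  have -> : (y + i%:R) ^+ p = y ^+ p + i%:R.
    have -> : (y + i%:R) ^+ p = y ^+ p + i%:R ^+ p.
      exact: (rmorphD (pFrobenius_aut pcharL)).
    by rewrite -[i%:R ^+ p]/(pFrobenius_aut pcharL _) rmorph_nat.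
  by rewrite -yE; apply/eqP; ring.
- by rewrite uniq_rootsE AS_roots_uniq.
Qed.

Lemma AS_polyOver : AS_poly \is a polyOver 1%VS.
Proof.
apply/polyOver1P; exists ('X^p - ('X + a%:P)).
by rewrite rmorphB rmorphD /= map_polyXn map_polyX map_polyC.
Qed.

Lemma AS_splitting : splittingFieldFor 1 AS_poly {:L}.
Proof.
exists AS_roots; first by rewrite AS_polyE eqpxx.
apply/eqP; rewrite eqEsubv subvf -y_gen.
apply/FadjoinP; split; first exact: subv_adjoin_seq.
apply: seqv_sub_adjoin; apply/mapP; exists 0%N; rewrite ?addr0 //.
by rewrite mem_iota prime_gt0.
Qed.

End Roots.

(** An automorphism is determined by the image y + i of y. Such translations commute, and their p-th
    powers are trivial. *)
Lemma AS_galois (L : splittingFieldType F) (y : L) :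
    y ^+ p - y = a%:A -> <<1; y>>%VS = {:L}%VS ->
  [/\ galois 1 {:L}, abelian 'Gal({:L} / 1)
    & (exponent 'Gal({:L} / 1) %| p)%N].
Proof.
move=> yE y_gen.
have pcharL : p \in [pchar L] := rmorph_pchar (in_alg L) pcharF.
have gal_eq (x x' : gal_of {:L}) :
    x \in 'Gal({:L} / 1)%g -> x' \in 'Gal({:L} / 1)%g -> x y = x' y -> x = x'.
  move=> galx galx' eqxy; apply/eqP/gal_eqP => z _.
  have : z \in <<1; y>>%VS by rewrite y_gen memvf.
  move=> /Fadjoin_polyP[Q Q1 ->].
  by rewrite -!horner_map !(fixedPoly_gal (sub1v _)) //= eqxy.
have gal_y (x : gal_of {:L}) : x \in 'Gal({:L} / 1)%g ->
    exists i : nat, x y = y + i%:R.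
  move=> galx; have : root (AS_poly L) (x y).
    rewrite -(fixedPoly_gal (sub1v _) galx (AS_polyOver L)) fmorph_root.
    by rewrite rootE !hornerE subr_eq0 addrC -subr_eq yE.
  rewrite (AS_polyE yE) root_prod_XsubC => /mapP[i _ ->].
  by exists i.
split.
- apply/splitting_galoisField; exists (AS_poly L); split.
  + exact: AS_polyOver.
  + by rewrite (AS_polyE yE) separable_prod_XsubC AS_roots_uniq.
  + exact: (AS_splitting yE y_gen).
- apply/centsP => x galx x' galx'.
  apply: gal_eq; rewrite ?groupM // !galM ?memvf //.
  have [[i xi] [j xj]] := (gal_y _ galx, gal_y _ galx').
  by rewrite xi xj !rmorphD !rmorph_nat /= xi xj addrAC.
- apply/exponentP => x galx; apply: gal_eq; rewrite ?groupX ?group1 //.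
  have [i xi] := gal_y _ galx; rewrite gal_id.
  have xn n : (x ^+ n)%g y = y + (n * i)%:R.
    elim: n => [|n IHn]; first by rewrite expg0 gal_id addr0.
    rewrite expgS galM ?memvf // xi rmorphD /= IHn rmorph_nat.
    by rewrite mulSn [(i + _)%N]addnC natrD addrA.
  by rewrite xn natrM (pcharf0 pcharL) mul0r addr0.
Qed.

Lemma AS_abelian (E : fieldType) (f : {rmorphism F -> E}) (x : E) :
  x ^+ p - x = f a -> abelian_killed_by p f x.
Proof.
move=> xE; have [|L [g [y [gE gy y_gen]]]] := @algebraic_extension F E f x.
  exists ('X^p - ('X + a%:P)).
    rewrite -size_poly_eq0 size_polyDl ?size_polyN size_polyXn //.
    by rewrite size_XaddC.
  rewrite rmorphB rmorphD /= map_polyXn map_polyX map_polyC rootE !hornerE.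
  by rewrite /= -xE; apply/eqP; ring.
have yE : y ^+ p - y = a%:A.
  by apply: (fmorph_inj g); rewrite rmorphB rmorphXn gy gE.
(* Adjoining one root already adjoins all its translates, so the simple extension is a splitting
   field. *)
have ax : splitting_field_axiom L.
  by exists (AS_poly L); [apply: AS_polyOver | apply: AS_splitting yE y_gen].
pose L' : splittingFieldType F :=
  HB.pack L (FieldExt_isSplittingField.Build F L ax).
exists L', g, y; split; first by split.
exact: (@AS_galois L' y yE y_gen).
Qed.

End ArtinSchreier.

(** * Algebraic series and linear recurrences *)

(** The gap lies just before a nonzero coefficient: a recurrence of order at most [D] can then be
    made to isolate that coefficient. *)
Definition lacunary (A : nmodType) (v : fps A) := forall D B, exists m,
  [/\ (B <= m)%N, v m != 0
    & forall j, (0 < j <= D)%N -> (j <= m)%N -> v (m - j)%N = 0].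

Section AlgebraicSeries.
Variables (K : fieldType) (s : bool) (u : fps K).
Hypothesis K_char0 : forall n, (n%:R == 0 :> K) = (n == 0%N).
Hypothesis u_alg : algebraicOver (@ratl K) (FracField.tofrac u).
Implicit Types (h a b v : fps K) (c : {poly K}) (G : {poly {poly K}}).

Local Notation dq := (delta_q s).
Local Notation q := (qn K s).
Local Notation toE := (@FracField.tofrac (fps K)).
Local Notation toF := (@FracField.tofrac {poly K}).

Definition eval_at_u G : fps K := (map_poly (@fps_of_poly K) G).[u].

Lemma eval_at_uC c : eval_at_u c%:P = fps_of_poly c.
Proof. by rewrite /eval_at_u map_polyC hornerC. Qed.

Lemma eval_at_u_cons G c :
  eval_at_u (G * 'X + c%:P) = eval_at_u G * u + fps_of_poly c.
Proof.
by rewrite /eval_at_u rmorphD rmorphM /= map_polyX map_polyC !hornerE.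
Qed.

Lemma delta_q_poly c : exists c', dq (fps_of_poly c) = fps_of_poly c'.
Proof.
exists (\poly_(i < size c) (q i * c`_i)); apply: fpsP => m.
rewrite delta_qE !fps_of_polyE coef_poly; case: ltnP => // le_cm.
by rewrite nth_default ?mulr0.
Qed.

(** The chain rule, with [G1] obtained by differentiating the coefficients of [G]. *)
Lemma delta_q_eval G : exists G1,
  dq (eval_at_u G) = eval_at_u G1 + eval_at_u G^`() * dq u.
Proof.
elim/poly_ind: G => [|G c [G1 IHG]].
  exists 0; rewrite deriv0 /eval_at_u rmorph0 horner0 mul0r addr0.
  exact: (raddf0 (@delta_q K s)).
have [c' cE] := delta_q_poly c; exists (G1 * 'X + c'%:P).
rewrite !eval_at_u_cons delta_qD delta_qM IHG cE.
rewrite derivD derivM derivX derivC mulr1 addr0.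
have -> : eval_at_u (G^`() * 'X + G) = eval_at_u G^`() * u + eval_at_u G.
  by rewrite /eval_at_u rmorphD rmorphM /= map_polyX !hornerE.
by ring.
Qed.

Lemma eval_at_u_clear (P : {poly {fraction {poly K}}}) : exists c G,
  [/\ c != 0, toF c *: P = map_poly toF G
    & toE (eval_at_u G) = poly_frac c * (map_poly (@ratl K) P).[toE u]].
Proof.
have [c [G [c0 PG]]] := frac_poly_clear P; exists c, G; split=> //.
rewrite -ratl_frac -hornerZ -map_polyZ PG -map_poly_comp.
rewrite (eq_map_poly (g := toE \o @fps_of_poly K)) => [|x]; last first.
  by rewrite /= ratl_frac.
by rewrite map_poly_comp horner_map.
Qed.

(** Take an annihilator of least size. In characteristic 0 its derivative is nonzero and smaller, so
    it cannot vanish at u. *)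
Lemma annihilator_separable : exists A : {poly {poly K}},
  eval_at_u A = 0 /\ eval_at_u A^`() != 0.
Proof.
pose good n := `[< exists A, [/\ A != 0, eval_at_u A = 0 & size A = n] >].
have ex_good : exists n, good n.
  have [P P0 Pu] := u_alg; have [c [G [c0 PG GE]]] := eval_at_u_clear P.
  exists (size G); apply/asboolP; exists G; split=> //.
    apply: contraNneq P0 => G0; move/eqP: PG; rewrite G0 rmorph0.
    by rewrite scaler_eq0 tofrac_eq0 (negPf c0).
  by apply/eqP; rewrite -tofrac_eq0 GE (eqP Pu) mulr0.
case: (ex_minnP ex_good) => n /asboolP[A [A0 uA sA]] Amin.
exists A; split=> //; apply: contraTneq isT => uA'.
have A1 : (1 < size A)%N.
  rewrite ltnNge; apply/negP => /size1_polyC AE.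
  move: uA A0; rewrite AE eval_at_uC polyC_eq0 => Ac /eqP[].
  by apply: fps_of_poly_inj; rewrite Ac rmorph0.
have A'0 : A^`() != 0.
  have sA2 : (size A).-2.+1 = (size A).-1 by case: (size A) A1 => [|[]].
  apply: contraNneq A0 => /(congr1 (fun P : {poly {poly K}} => P`_(size A).-2)).
  rewrite coef_deriv coef0 sA2 -lead_coefE -mulr_natl => /eqP.
  rewrite mulf_eq0 lead_coef_eq0 => /orP[|//].
  rewrite -polyC_natr polyC_eq0 K_char0.
  by case: (size A) A1 => [|[]].
have : (n <= size A^`())%N by apply: Amin; apply/asboolP; exists A^`().
by rewrite -sA leqNgt lt_size_deriv.
Qed.

Section Image.
Variables (L : fieldExtType {fraction {poly K}}).
Variables (g : {rmorphism L -> {fraction fps K}}) (y : L).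
Hypothesis gE : forall x : {fraction {poly K}}, g x%:A = ratl x.
Hypothesis gy : g y = toE u.
Hypothesis y_gen : <<1; y>>%VS = {:L}%VS.

(** Membership in the subfield K(q)(u) of the fraction field of series, realised as the image of the
    finite extension [L]. *)
Definition in_image h := exists l, g l = toE h.

Lemma in_image_poly c : in_image (fps_of_poly c).
Proof. by exists (toF c)%:A; rewrite gE ratl_frac. Qed.

Lemma in_imageD a b : in_image a -> in_image b -> in_image (a + b).
Proof. by move=> [l la] [l' lb]; exists (l + l'); rewrite !rmorphD la lb. Qed.

Lemma in_imageM a b : in_image a -> in_image b -> in_image (a * b).
Proof. by move=> [l la] [l' lb]; exists (l * l'); rewrite !rmorphM la lb. Qed.

Lemma in_imageN a : in_image a -> in_image (- a).
Proof. by move=> [l la]; exists (- l); rewrite !rmorphN la. Qed.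

Lemma in_image_div a b h : b != 0 -> b * h = a ->
  in_image a -> in_image b -> in_image h.
Proof.
move=> b0 <- [l la] [l' lb]; exists (l / l').
by rewrite rmorphM fmorphV la lb /= rmorphM /= mulrC mulKf // tofrac_eq0.
Qed.

Lemma in_image_eval G : in_image (eval_at_u G).
Proof.
elim/poly_ind: G => [|G c IHG].
  by rewrite -polyC0 eval_at_uC; apply: in_image_poly.
rewrite eval_at_u_cons; apply: in_imageD; last exact: in_image_poly.
by apply: in_imageM => //; exists y.
Qed.

(** Implicit differentiation of A(u) = 0, solved for delta_q u by dividing by A'(u). *)
Lemma in_image_delta_u : in_image (dq u).
Proof.
have [A [A0 A'0]] := annihilator_separable; have [A1 AE] := delta_q_eval A.
apply: (in_image_div (a := - eval_at_u A1) A'0); last exact: in_image_eval.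
  apply/eqP; rewrite -addr_eq0 addrC -AE A0.
  by apply/eqP; apply: (raddf0 (@delta_q K s)).
exact/in_imageN/in_image_eval.
Qed.

(** Clearing denominators gives c h = G(u) with c a nonzero polynomial in the variable of the
    series; differentiate both sides and divide by c. *)
Lemma in_image_delta h : in_image h -> in_image (dq h).
Proof.
move=> hI; have [l lh] := hI.
have : l \in <<1; y>>%VS by rewrite y_gen memvf.
move=> /Fadjoin_polyP[Q /polyOver1P[P QP] lE].
have hE : toE h = (map_poly (@ratl K) P).[toE u].
  rewrite -lh lE -gy -horner_map QP -map_poly_comp; congr (_.[_]).
  by apply: eq_map_poly => a; apply: gE.
have [c [G [c0 _]]] := eval_at_u_clear P; rewrite -hE.
rewrite -[poly_frac c]/(toE (fps_of_poly c)) -tofracM => /eqP.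
rewrite tofrac_eq => /eqP GE; have [c' cE] := delta_q_poly c.
have [G1] := delta_q_eval G; rewrite GE delta_qM cE => dE.
have fc0 : fps_of_poly c != 0.
  apply: contraNneq c0 => fc0; apply/eqP/fps_of_poly_inj.
  by rewrite fc0 rmorph0.
apply: (in_image_div (a := eval_at_u G1 + eval_at_u G^`() * dq u
  - fps_of_poly c' * h) fc0).
- by rewrite -dE addrC addKr.
- apply: in_imageD; last first.
    by apply/in_imageN/in_imageM => //; apply: in_image_poly.
  apply: in_imageD; first exact: in_image_eval.
  by apply: in_imageM; [apply: in_image_eval | apply: in_image_delta_u].
- exact: in_image_poly.
Qed.

Lemma in_image_ode v : in_image v -> exists N (Q : {poly {poly K}}),
  [/\ Q != 0, (size Q <= N)%N
    & \sum_(i < N) fps_of_poly Q`_i * iter i dq v = 0].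
Proof.
move=> vI; have iterI i : in_image (iter i dq v).
  by elim: i => // i IHi; rewrite iterS; apply: in_image_delta.
(* One more iterated derivative than the dimension of [L] forces a linear relation over K(q);
   clearing its denominators gives the coefficients of [Q]. *)
have /choice[l lE] := iterI; pose N := (\dim {:L}).+1.
pose X := [tuple l i | i < N].
have XE (i : 'I_N) : X`_i = l i by rewrite -tnth_nth tnth_mktuple.
have /freeP : ~~ free X.
  rewrite /free size_tuple neq_ltn /N ltnS; apply/orP; left.
  exact/dimvS/subvf.
case/existsNP => k /not_implyP[kX] /existsNP[i0 ki0].
pose P := \poly_(i < N) k (inord i); have [c [Q [c0 PQ]]] := frac_poly_clear P.
have QE i : toF Q`_i = toF c * P`_i by rewrite -coefZ PQ coef_map.
have P0 : P != 0.
  apply/eqP => /(congr1 (fun P : {poly _} => P`_i0)).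
  by rewrite coef_poly ltn_ord inord_val coef0.
exists N, Q; split.
- apply: contraNneq P0 => Q0; move/eqP: PQ; rewrite Q0 rmorph0.
  by rewrite scaler_eq0 tofrac_eq0 (negPf c0).
- apply/leq_sizeP => j leNj; apply/eqP; rewrite -tofrac_eq0 QE.
  by rewrite coef_poly ltnNge leNj mulr0.
apply/eqP; rewrite -tofrac_eq0 rmorph_sum; apply/eqP.
transitivity (ratl (toF c) * g (\sum_i k i *: X`_i)); last first.
  by rewrite kX rmorph0 mulr0.
rewrite rmorph_sum mulr_sumr; apply: eq_bigr => i _.
rewrite XE /= tofracM -[toE (fps_of_poly _)]/(poly_frac _) -ratl_frac QE.
rewrite rmorphM -mulrA coef_poly ltn_ord inord_val.
by rewrite -mulr_algl rmorphM /= gE lE.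
Qed.

End Image.

Lemma algebraic_ode v : u != 0 -> v * u = dq u ->
  exists N (Q : {poly {poly K}}),
  [/\ Q != 0, (size Q <= N)%N
    & \sum_(i < N) fps_of_poly Q`_i * iter i dq v = 0].
Proof.
move=> u0 vu; have [L [g [y [gE gy y_gen]]]] := algebraic_extension u_alg.
apply: (in_image_ode gE gy y_gen).
apply: (in_image_div u0 (a := dq u)); first by rewrite mulrC.
  exact: (in_image_delta_u gE gy).
by exists y.
Qed.

Lemma qn_inj : injective q.
Proof.
have lem m n : (m <= n)%N -> q m = q n -> m = n.
  move=> le_mn /eqP; rewrite !qnE (inj_eq (mulfI (negbT (signr_eq0 K s)))).
  rewrite eq_sym -subr_eq0 -natrB // K_char0 subn_eq0 => le_nm.
  by apply/eqP; rewrite eqn_leq le_mn.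
by move=> m n; case: (leqP m n) => [|/ltnW] le eqq; [|symmetry]; apply: lem.
Qed.

(** A differential equation is a recurrence on coefficients whose multipliers are polynomials in the
    exponent. Each long gap isolates one term of it and yields a root of a fixed nonzero multiplier,
    so that multiplier has too many roots. *)
Lemma lacunary_ode N (Q : {poly {poly K}}) v :
    lacunary v -> Q != 0 -> (size Q <= N)%N ->
  \sum_(i < N) fps_of_poly Q`_i * iter i dq v <> 0.
Proof.
move=> vL Q0 sQ ode; pose r j := \poly_(i < N) (Q`_i)`_j : {poly K}.
have rec m : \sum_(j < m.+1) (r j).[q (m - j)] * v (m - j)%N = 0.
  rewrite -[RHS]/((0 : fps K) m) -ode fps_sum.
  transitivity (\sum_(i < N) \sum_(j < m.+1)
    (Q`_i)`_j * (q (m - j) ^+ i * v (m - j)%N)).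
    rewrite exchange_big; apply: eq_bigr => j _.
    by rewrite horner_poly mulr_suml; apply: eq_bigr => i _; rewrite mulrA.
  apply: eq_bigr => i _; rewrite fpsM; apply: eq_bigr => j _.
  by rewrite iter_delta_qE.
have r_neq0 : exists j, r j != 0.
  have lQ : lead_coef Q != 0 by rewrite lead_coef_eq0.
  exists (size (lead_coef Q)).-1; apply/eqP.
  move/(congr1 (fun P : {poly K} => P`_(size Q).-1)); rewrite coef_poly coef0.
  rewrite (leq_trans _ sQ) ?prednK ?size_poly_gt0 // -lead_coefE.
  by move/eqP; rewrite -lead_coefE lead_coef_eq0 (negPf lQ).
case: (ex_minnP r_neq0) => j0 rj0 jmin.
pose D := \max_(i < N) size (Q`_i)%R.
have rD j : (D <= j)%N -> r j = 0.
  move=> leDj; apply/polyP => i; rewrite coef_poly coef0; case: ltnP => // ltiN.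
  rewrite nth_default // (leq_trans _ leDj) //.
  exact: (leq_bigmax (Ordinal ltiN)).
have roots B : exists2 m, (B <= m)%N & root (r j0) (q m).
  have [m [leBm vm vgap]] := vL D B; exists m => //.
  (* At index m + j0, terms with j < j0 vanish by minimality of j0, those with j - j0 >= D because
     [r j] = 0, and the others with j > j0 by the gap before m. *)
  have lt0 : (j0 < (m + j0).+1)%N by rewrite ltnS leq_addl.
  have := rec (m + j0)%N; rewrite (bigD1 (Ordinal lt0)) //= addnK big1.
    by rewrite addr0 => /eqP; rewrite mulf_eq0 (negPf vm) orbF.
  move=> j nj; case: (ltngtP j j0) => [ltj|gtj|ej]; last first.
  - by case/eqP: nj; apply: val_inj.
  - case: (leqP D (j - j0)) => [leD|gtD].
      by rewrite rD ?horner0 ?mul0r // (leq_trans leD) ?leq_subr.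
    have lejm : (j <= m + j0)%N by rewrite -ltnS.
    have -> : (m + j0 - j = m - (j - j0))%N by lia.
    by rewrite vgap ?mulr0 //; lia.
  have /eqP -> : r j == 0 by apply: contraLR ltj => /jmin; rewrite -leqNgt.
  by rewrite horner0 mul0r.
(* [B] bounds the roots already found, so a root taken beyond it is new. *)
have many n : exists (rs : seq nat) B,
    [/\ size rs = n, uniq rs, all (ltn^~ B) rs & all (root (r j0)) (map q rs)].
  elim: n => [|n [rs [B [srs urs ltrs rootrs]]]]; first by exists [::], 0%N.
  have [m leBm rm] := roots B; exists (m :: rs), m.+1; split=> /=.
  - by rewrite srs.
  - rewrite urs andbT; apply/negP => /(allP ltrs) /=.
    by rewrite ltnNge leBm.
  - rewrite ltnSn; apply/allP => i /(allP ltrs) /= ltiB.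
    by rewrite ltnS ltnW // (leq_trans ltiB).
  - by rewrite rm.
have [rs [B [srs urs _ rootrs]]] := many (size (r j0)).
have := max_poly_roots rj0 rootrs.
rewrite map_inj_uniq; last exact: qn_inj.
by move=> /(_ urs); rewrite size_map srs ltnn.
Qed.

End AlgebraicSeries.

(** * Properties of the solution *)

(** Here [T] is the support or its opposite, so that both signs give bounds on indices; b / a < p /
    2 yields b < p a. *)
Lemma short_pos_bounds p (A : nmodType) (f : fps A) (T : set int) :
    (0 < p)%N -> (forall m, f m != 0 -> T m%:Z) ->
    (forall n, T n -> f `|n|%N != 0) -> short_pos p T ->
  exists a b, [/\ (0 < a)%N, f a != 0, (b < p * a)%N
    & forall m, f m != 0 -> (a <= m <= b)%N].
Proof.
move=> p_gt0 fT Tf [_ T_gt0 [a [b [Ta Tb Tab ba]]]].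
have a_gt0 := T_gt0 _ Ta; have b_gt0 := T_gt0 _ Tb.
exists `|a|%N, `|b|%N; split; [by lia | exact: Tf | | ].
  move: ba; rewrite ltr_pdivrMr ?ltr0z // => ba.
  have : b%:Q < p%:Q * a%:Q.
    apply: (lt_le_trans ba); rewrite ler_pM2r ?ltr0z //.
    by rewrite ler_pdivrMr // ler_peMr ?ler0z // ler1n.
  by rewrite -intrM ltr_int; lia.
by move=> m /fT/Tab; lia.
Qed.

Lemma short_bounds p s (A : nmodType) (f : fps A) :
    (0 < p)%N -> short p (supp s f) ->
  exists a b, [/\ (0 < a)%N, f a != 0, (b < p * a)%N
    & forall m, f m != 0 -> (a <= m <= b)%N].
Proof.
have absq m : `|qexp s m|%N = m by rewrite /qexp abszM abszX exp1n mul1n.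
move=> p_gt0 [] sS; move: (sS) => [_ S_gt0 _].
  apply: short_pos_bounds sS => // [m fm|_ [m -> fm]]; last by rewrite absq.
  have Sm : supp s f (qexp s m) by exists m.
  by have /gtz0_abs := S_gt0 _ Sm; rewrite absq => ->.
apply: short_pos_bounds sS => // [m fm|n [m En fm]]; last first.
  by rewrite -abszN En absq.
have Sm : supp s f (- - qexp s m) by rewrite opprK; exists m.
have := S_gt0 _ Sm => /gtz0_abs; rewrite abszN absq => ->.
by rewrite /= opprK; exists m.
Qed.

Section SolutionProperties.
Variables (p : nat) (R : idomainType) (k : fieldType).
Variable red : {rmorphism R -> k}.
Variables (phi : {rmorphism R -> R}) (s : bool).
Hypotheses (hR : unramified_completion p red) (hphi : frobenius_lift p red phi).
Variables (nu : {poly {poly R}}) (lambda : {poly R}).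
Hypothesis hnd : nondeg_char (char_poly2 p nu lambda).

Let p_prime := uc_prime hR.
Let p_gt0 : (0 < p)%N := prime_gt0 p_prime.
Let p_gt1 : (1 < p)%N := prime_gt1 p_prime.
Let pchark := residue_pchar hR.
Local Notation phip := (phi_p p phi).
Local Notation dq := (delta_q s).
Local Notation q := (qn R s).
Local Notation mu_op := (mu_op p phi s nu lambda).
Local Notation mu_diag := (mu_diag s nu lambda).

Section Linear.
Variables (f v : fps R).
Hypotheses (f_nonchar : totally_nonchar p s nu lambda f).
Hypotheses (v0 : v 0%N = 0) (vE : mu_op v = dq f).
Hypothesis vK : forall m, mu_diag m = 0 -> v m = 0.

Lemma coprime_coef m : ~~ (p %| m)%N -> mu_diag m * v m = q m * f m.
Proof.
move=> pm; rewrite -(mu_op_diag phi s hR nu lambda (v := v)) ?vE //.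
move=> i i_gt0 pim; case/negP: pm; apply: dvdn_trans pim.
exact: dvdn_exp.
Qed.

Lemma red_phi_sub m : (p %| m)%N -> red ((phip v - v) m) = 0.
Proof.
move=> /dvdnP[j ->].
have [z ->] := linear_solution_congr hR hnd v0 vE (j * p)%N.
by rewrite natrM !rmorphM !rmorph_nat (pcharf0 pchark) mulr0 mul0r.
Qed.

(** For [m] prime to p the equation reads mu(0, n) v_m = n f_m, where n is a unit, and mu(0, n) is
    one as soon as f_m is nonzero. *)
Lemma red_coprime_coef m : ~~ (p %| m)%N -> (red (v m) == 0) = (red (f m) == 0).
Proof.
move=> pm; have E := coprime_coef pm.
have rq : red (q m) != 0.
  rewrite qnE rmorphM rmorph_nat mulf_neq0 //; last first.
    by rewrite -(dvdn_pcharf pchark).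
  by rewrite rmorphXn rmorphN1 signr_eq0.
have [fm|fm] := eqVneq (f m) 0.
  move/eqP: E; rewrite fm mulr0 mulf_eq0 => /orP[/eqP/vK|/eqP] ->.
    by rewrite !rmorph0 eqxx.
  by rewrite !rmorph0 eqxx.
have [_ cU] := f_nonchar fm.
have rc : red (mu_diag m) != 0 by rewrite -unitfE rmorph_unit.
have := congr1 red E; rewrite !rmorphM => rE.
rewrite -(inj_eq (mulfI rc)) rE mulr0 mulf_eq0 (negPf rq).
by [].
Qed.

(** Mod p, v^p - v is phi_p v - v. Its coefficients at multiples of p vanish, and at [m] prime to p
    the coefficient is -v_m, which vanishes wherever f_m does mod p. *)
Lemma red_solution (P : {poly k}) : map_fps red f = fps_of_poly P ->
  exists G : {poly k},
    map_fps red v ^+ p - map_fps red v = fps_of_poly G.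
Proof.
move=> fP; rewrite -(map_fps_phi_p v pchark (fl_red hphi)).
exists (\poly_(m < size P) red ((phip v - v) m)).
apply: fpsP => m; rewrite fpsB !map_fpsE -rmorphB -fpsB fps_of_polyE coef_poly.
case: ltnP => // lePm; have [/red_phi_sub //|pm] := boolP (p %| m)%N.
rewrite fpsB phi_pE (negPf pm) sub0r rmorphN; apply/eqP.
rewrite oppr_eq0 red_coprime_coef // -map_fpsE fP fps_of_polyE.
by rewrite nth_default.
Qed.

Lemma integral_psi_q (P : {poly k}) : map_fps red f = fps_of_poly P ->
  integralOver (@fps_of_poly k) (map_fps red v).
Proof.
move=> /red_solution[G GE]; exists ('X^p - ('X + G%:P)).
  rewrite monicE lead_coefDl ?lead_coefXn // size_polyN size_polyXn.
  by rewrite size_XaddC.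
rewrite rmorphB rmorphD /= map_polyXn map_polyX map_polyC rootE !hornerE.
by rewrite /= -GE; apply/eqP; ring.
Qed.

Lemma abelian_psi_q (P : {poly k}) : map_fps red f = fps_of_poly P ->
  abelian_killed_by p (@ratl k) (FracField.tofrac (map_fps red v)).
Proof.
move=> /red_solution[G GE].
have pcharF : p \in [pchar {fraction {poly k}}].
  exact: (rmorph_pchar (@FracField.tofrac {poly k} \o polyC) pchark).
apply: (AS_abelian (a := FracField.tofrac G) pcharF).
by rewrite -tofracXn -tofracB GE /= ratl_frac.
Qed.

(** The coefficient at p^(e+1) a is congruent mod p to the image under [phi] of the one at p^e a,
    and Frobenius on the residue field preserves nonzero elements. *)
Lemma red_pexp_coef a e : ~~ (p %| a)%N -> red (f a) != 0 ->
  red (v (p ^ e * a)%N) != 0.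
Proof.
move=> pa fa; elim: e => [|e IHe]; first by rewrite mul1n red_coprime_coef.
have := red_phi_sub (m := (p ^ e.+1 * a)%N).
rewrite expnS -mulnA dvdn_mulr // => /(_ isT).
rewrite fpsB phi_pE dvdn_mulr // mulKn // rmorphB (fl_red hphi) => /eqP.
by rewrite subr_eq0 => /eqP <-; rewrite expf_neq0.
Qed.

End Linear.

(** Dividing f by the exact power of p in its coefficients leaves a series with a coefficient
    nonzero mod p. By uniqueness v is divided by the same power, and nonvanishing propagates along
    p^e a. *)
Lemma infinite_support (f v : fps R) : f 0%N = 0 ->
    totally_nonchar p s nu lambda f -> v 0%N = 0 -> mu_op v = dq f ->
    (forall m, mu_diag m = 0 -> v m = 0) -> f != 0 ->
  exists2 a, f a != 0 & forall e, v (p ^ e * a)%N != 0.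
Proof.
move=> f0 f_nonchar v0 vE vK f_neq0.
pose good N := `[< exists m, ~ divides (p ^ N.+1)%:R (f m) >].
have ex_good : exists N, good N.
  apply: contrapT => /forallNP nogood; case/eqP: f_neq0; apply: fpsP => m.
  apply: (divides_pexp_eq0 hR) => N; apply: contrapT => Nm.
  apply: (nogood N); apply/asboolP; exists m => -[z fz]; apply: Nm.
  by exists (p%:R * z); rewrite mulrA -natrM -expnSr.
case: (ex_minnP ex_good) => N /asboolP[a na] Nmin.
have dN m : divides (p ^ N)%:R (f m).
  case: N Nmin {na} => [|N] Nmin; first by exists (f m); rewrite mul1r.
  apply: contrapT => ndm; have /Nmin : good N by apply/asboolP; exists m.
  by rewrite ltnn.
have [f' fE] := fps_divides dN.
have pN0 : (p ^ N)%:R != 0 :> R.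
  by rewrite (ground_natr_eq0 hR) expn_eq0 gtn_eqF.
have f'_neq0 m : f' m != 0 -> f m != 0.
  by move=> f'm; rewrite fE fps_natM mulf_neq0.
have f'_nonchar : totally_nonchar p s nu lambda f'.
  by move=> m /f'_neq0/f_nonchar.
have f'a : red (f' a) != 0.
  apply/eqP => /(red_eq0P hR)[z zE]; apply: na; exists z.
  by rewrite fE fps_natM zE mulrA -natrM -expnSr.
have fa : f a != 0.
  by apply: f'_neq0; apply: contraNneq f'a => ->; rewrite rmorph0.
have [pa _] := f_nonchar _ fa.
have [v' [v'0 v'E v'K]] := linear_solution phi hR hnd f'_nonchar.
exists a => // e.
have -> : v = (p ^ N)%:R * v'.
  apply: (linear_solution_uniq hR v0 (phi := phi) (s := s) (nu := nu)
    (lambda := lambda)) => //.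
  - by rewrite fps_natM v'0 mulr0.
  - rewrite vE fE delta_q_nat -v'E !mulr_natl.
    by rewrite [in RHS]raddfMn.
  - by move=> m cm; rewrite fps_natM v'K ?mulr0.
rewrite fps_natM mulf_neq0 //.
have := red_pexp_coef f'_nonchar v'0 v'E v'K e pa f'a.
by apply: contraNneq => ->; rewrite rmorph0.
Qed.

Lemma lacunary_psi_q (f v : fps R) : f 0%N = 0 ->
    totally_nonchar p s nu lambda f -> v 0%N = 0 -> mu_op v = dq f ->
    (forall m, mu_diag m = 0 -> v m = 0) -> short p (supp s f) ->
  lacunary v.
Proof.
move=> f0 f_nonchar v0 vE vK.
move=> /(short_bounds p_gt0)[a [b [a_gt0 fa ltb fab]]] D B.
have f_neq0 : f != 0 by apply: contraNneq fa => ->.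
have [c fc vc] := infinite_support f0 f_nonchar v0 vE vK f_neq0.
have /andP[leac lecb] := fab _ fc.
(* With this [e] the power p^e exceeds both the required gap and the required index. *)
pose e := (D + B)%N; have ltD : (D < p ^ e)%N.
  by apply: leq_ltn_trans (ltn_expl e p_gt1); apply: leq_addr.
have ltB : (B < p ^ e)%N.
  by apply: leq_ltn_trans (ltn_expl e p_gt1); apply: leq_addl.
(* [m] will be the first index of the support of v from p^(e+1) a on; the infinite sequence p^i c in
   that support ensures that it exists. *)
have ex_m : exists m, (p ^ e.+1 * a <= m)%N && (v m != 0).
  by exists (p ^ e.+1 * c)%N; rewrite leq_mul2l leac orbT vc.
case: (ex_minnP ex_m) => m /andP[lem vm] mmin; exists m; split=> //.
  apply: leq_trans lem; rewrite (leq_trans (ltnW ltB)) // expnS.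
  by rewrite mulnAC leq_pmull // muln_gt0 p_gt0.
move=> j /andP[j_gt0 lejD] lejm; apply/eqP; apply: contrapT => /negP vmj.
have lt_mj : (m - j < p ^ e.+1 * a)%N.
  rewrite ltnNge; apply/negP => le_mj.
  have : (m <= m - j)%N by apply: mmin; rewrite le_mj.
  by lia.
(* A support index m - j below p^(e+1) a lies in some p^i [a, b] with i <= e, hence is at most p^e
   b. Since b + 1 <= p a, it is at least p^e away from [m], more than [D]. *)
have [i pij fi] := linear_solution_supp hR v0 vE vK vmj.
have /andP[lea leb] := fab _ fi; set d := ((m - j) %/ p ^ i)%N in fi lea leb.
have mjE : (m - j = d * p ^ i)%N by rewrite /d divnK.
have lt_ie : (i < e.+1)%N.
  rewrite -(ltn_exp2l _ _ p_gt1) -(ltn_pmul2r a_gt0).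
  by apply: leq_ltn_trans lt_mj; rewrite mjE mulnC leq_mul2r lea orbT.
have le_pie : (d * p ^ i <= b * p ^ e)%N by rewrite leq_mul // leq_exp2l.
have : (p ^ e * b.+1 <= p ^ e.+1 * a)%N by rewrite expnSr -mulnA leq_mul.
by rewrite -mjE in le_pie; lia.
Qed.

(** The gaps of psi_q u and the relation delta_q u = v u are carried from R to its fraction field;
    algebraicity of u would give a differential equation for v that the gaps exclude. *)
Lemma transcendental_solution (f u : fps R) : f 0%N = 0 ->
    totally_nonchar p s nu lambda f -> is_solution p phi s nu lambda f u ->
    short p (supp s f) ->
  transcendental_over_ratl (map_fps (@FracField.tofrac R) u).
Proof.
move=> f0 f_nonchar /(is_solutionP s hR hphi nu lambda _ f0)[u0 uE uK] f_short.
pose iota := @FracField.tofrac R; set v := psi_q s u in uE uK.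
have v_lac : lacunary (map_fps iota v).
  move=> D B.
  have [m [leBm vm vgap]] :=
    lacunary_psi_q f0 f_nonchar (psi_q0 s u0) uE uK f_short D B.
  exists m; split; rewrite // ?map_fpsE ?tofrac_eq0 // => j ltj lej.
  by rewrite map_fpsE vgap // rmorph0.
have K_char0 n : (n%:R == 0 :> {fraction R}) = (n == 0%N).
  by rewrite -(rmorph_nat iota) tofrac_eq0 (ground_natr_eq0 hR).
have dqE h : map_fps iota (dq h) = dq (map_fps iota h).
  apply: fpsP => m; rewrite map_fpsE !delta_qE map_fpsE rmorphM.
  by congr (_ * _); apply: rmorph_int.
have u_neq0 : map_fps iota u != 0.
  apply/eqP => /(congr1 (fun h : fps {fraction R} => h 0%N)).
  by rewrite map_fpsE u0 rmorph1 => /eqP; rewrite oner_eq0.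
have vu : map_fps iota v * map_fps iota u = dq (map_fps iota u).
  by rewrite -dqE -(psi_qE s u0); symmetry; apply: rmorphM.
move=> u_alg; have [N [Q [Q0 sQ]]] := algebraic_ode K_char0 u_alg u_neq0 vu.
exact: (lacunary_ode K_char0 v_lac Q0 sQ).
Qed.

End SolutionProperties.

Theorem corollary7p14
  (p : nat) (R : idomainType) (k : fieldType) (red : {rmorphism R -> k})
  (phi : {rmorphism R -> R})
  (hR : unramified_completion p red) (hp : p <> 2%N)
  (hphi : frobenius_lift p red phi)
  (s : bool) (nu : {poly {poly R}}) (lambda : {poly R})
  (hnd : nondeg_char (char_poly2 p nu lambda))
  (f : fps R) (hf0 : f 0%N = 0)
  (hf : (supp s f
         `<=` totally_nonchar_ints p red (char_poly2 p nu lambda))%classic) :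
  (exists! u : fps R, is_solution p phi s nu lambda f u) /\
  (forall u : fps R, is_solution p phi s nu lambda f u ->
    ((exists P : {poly k}, map_fps red f = fps_of_poly P) ->
      integralOver (@fps_of_poly k) (map_fps red (psi_q s u)) /\
      abelian_killed_by p (@ratl k)
        (FracField.tofrac (map_fps red (psi_q s u)))) /\
    (unmixed red (char_poly2 p nu lambda) -> short p (supp s f) ->
      transcendental_over_ratl (map_fps (@FracField.tofrac R) u))).
Proof.
have f_nonchar : totally_nonchar p s nu lambda f := totally_noncharP hR hf.
split.
  have [u u_sol] := solution_exists hR hphi hnd hf0 f_nonchar.
  exists u; split=> // u' u'_sol.
  exact: (solution_unique hR hphi hf0 u_sol u'_sol).
move=> u u_sol; split; last first.
  by move=> _; apply: (transcendental_solution hR hphi hnd hf0 f_nonchar u_sol).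
have [u0 uE uK] := (is_solutionP s hR hphi nu lambda u hf0).1 u_sol.
move=> [P fP]; split.
  exact: (integral_psi_q hR hphi hnd f_nonchar (psi_q0 s u0) uE uK fP).
exact: (abelian_psi_q hR hphi hnd f_nonchar (psi_q0 s u0) uE uK fP).
Qed.
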